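(* Let $\Gamma$ be a finite connected network, let $h:\Gamma\to\mathbb{R}$ be continuous and let $c>0$ be a constant. Then the Kazdan-Warner problem $$\begin{cases}\partial^2 u=c-he^u & \text{on } e_j,\ j\in J,\\ u_j(v_i)=u_k(v_i) & j,k\in Inc_i,\ v_i\in V,\\ \sum_{j\in Inc_i}\partial_j u(v_i)=0 & v_i\in V,\end{cases}$$ has a solution $u$ if and only if $h$ is positive somewhere, i.e. $\{x\in\Gamma: h(x)>0\}\neq\emptyset$.
   Context: Network: $\Gamma=(V,E)$ consists of a finite collection of points (vertices) $V=\{v_i\}_{i\in I}\subset\mathbb{R}^n$ connected by a finite collection of continuous non-self-intersecting edges $E=\{e_j\}_{j\in J}$ ($J\neq\emptyset$), where any two edges can intersect only at a vertex. Each edge is parametrized by a continuous injective map $\pi_j:[0,l_j]\to\mathbb{R}^n$, $l_j>0$, whose endpoints $\pi_j(0),\pi_j(l_j)$ are vertices, with $e_j=\pi_j((0,l_j))$ containing no vertex. $\Gamma$ is assumed connected. $Inc_i=\{j\in J: e_j\text{ is incident to }v_i\}$. For $u:\Gamma\to\mathbb{R}$, $u_j:[0,l_j]\to\mathbb{R}$ denotes the restriction of $u$ to edge $j$ in the coordinate $y=\pi_j^{-1}(x)$, and $u_j(v_i)$ means $u_j(\pi_j^{-1}(v_i))$. Derivatives $\partial u,\partial^2u$ on an edge are with respect to the coordinate $y\in(0,l_j)$. At a vertex $v_i$ and $j\in Inc_i$, the oriented derivative is $\partial_j u(v_i)=\lim_{x\in e_j,\,x\to v_i}\frac{u_j(\pi_j^{-1}(x))-u_j(\pi_j^{-1}(v_i))}{|\pi_j^{-1}(x)-\pi_j^{-1}(v_i)|}$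 (derivative pointing from the vertex into the edge). $u$ is continuous on $\Gamma$ if each $u_j\in C([0,l_j])$ and $u_j(v_i)=u_k(v_i)$ for all $i\in I$, $j,k\in Inc_i$. $C^2(\Gamma)$ is the space of continuous functions on $\Gamma$ with $u_j\in C^2([0,l_j])$ for every $j$. A solution of the problem is a function $u\in C^2(\Gamma)$ satisfying it pointwise (strong solution). *)

(* Defs.v *)
From HB Require Import structures.
From mathcomp Require Import all_boot all_order all_algebra.
From mathcomp Require Import all_classical all_reals all_analysis.

Set Implicit Arguments.
Unset Strict Implicit.
Unset Printing Implicit Defensive.

Import Order.TTheory GRing.Theory Num.Theory.
Import numFieldNormedType.Exports.

Local Open Scope classical_set_scope.
Local Open Scope ring_scope.

(* The space R^n is 'rV[R]_n. The parametrizations are total functions on R;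
   only their values on [0, l_j] are meaningful. *)
Record network (R : realType) (n : nat) := Network {
  vertex : finType;
  edge : finType;
  vpos : vertex -> 'rV[R]_n;
  elen : edge -> R;
  epar : edge -> R -> 'rV[R]_n;
  vpos_inj : injective vpos;
  edge_nonempty : (0 < #|edge|)%N;
  elen_gt0 : forall j, 0 < elen j;
  epar_continuous : forall j, {within `[0, elen j], continuous (epar j)};
  epar_inj : forall j, {in `[0, elen j] &, injective (epar j)};
  epar_left : forall j, range vpos (epar j 0);
  epar_right : forall j, range vpos (epar j (elen j));
  edge_no_vertex : forall j,
    (epar j @` `]0, elen j[) `&` range vpos = set0;
  edge_meet : forall j k, j != k ->
    (epar j @` `[0, elen j]) `&` (epar k @` `[0, elen k]) `<=` range vpos;
  network_connected :
    connected (range vpos `|` \bigcup_j (epar j @` `]0, elen j[))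
}.

Section Network.
Context (R : realType) (n : nat) (G : network R n).
Implicit Types (u h : 'rV[R]_n -> R) (i : vertex G) (j : edge G).

Definition edge_set j : set 'rV[R]_n := epar j @` `]0, elen j[.

Definition net_points : set 'rV[R]_n :=
  range (@vpos R n G) `|` \bigcup_j edge_set j.

Definition incident i j : bool :=
  (vpos i == epar j 0) || (vpos i == epar j (elen j)).

(* The inverse of epar j, from epar j @` [0, elen j] onto [0, elen j]. *)
Definition ecoord j : 'rV[R]_n -> R :=
  'pinv_(fun=> 0) `[0, elen j] (epar j).

(* A function on the network is a function on R^n of which only the values on
   [net_points] are ever used. *)
Definition on_edge u j : R -> R := u \o epar j.

Definition at_vertex u j i : R := on_edge u j (ecoord j (vpos i)).

Definition vertex_compatible u : Prop :=
  forall i j k, incident i j -> incident i k ->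
    at_vertex u j i = at_vertex u k i.

Definition net_continuous u : Prop :=
  (forall j, {within `[0, elen j], continuous (on_edge u j)}) /\
  vertex_compatible u.

(* C^2([a, b]) : f is continuous on [a, b], twice differentiable on ]a, b[, and
   its first two derivatives extend continuously to [a, b]. *)
Definition C2_itv (a b : R) (f : R -> R) : Prop :=
  [/\ {within `[a, b], continuous f},
      {in `]a, b[, forall y, derivable f y 1},
      {in `]a, b[, forall y, derivable (f^`()%classic) y 1} &
      forall k, (0 < k <= 2)%N ->
        exists2 g : R -> R, {within `[a, b], continuous g} &
          {in `]a, b[, forall y, (f^`(k)%classic) y = g y}].

Definition net_C2 u : Prop :=
  net_continuous u /\ forall j, C2_itv 0 (elen j) (on_edge u j).

(* Derivative of u at the vertex i along the edge j, pointing into the edge. *)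
Definition oriented_derivative u j i : R :=
  lim ((fun x => (on_edge u j (ecoord j x) - at_vertex u j i) /
                 `|ecoord j x - ecoord j (vpos i)|)
       @ within (edge_set j) (nbhs (vpos i))).

Definition kazdan_warner_solution (c : R) h u : Prop :=
  [/\ net_C2 u,
      forall j, {in `]0, elen j[, forall y,
        ((on_edge u j)^`(2)%classic) y = c - on_edge h j y * expR (on_edge u j y)},
      vertex_compatible u &
      forall i, \sum_(j | incident i j) oriented_derivative u j i = 0].

End Network.

Arguments net_points {R n} G.
Arguments net_continuous {R n} G u.
Arguments kazdan_warner_solution {R n} G c h u.

(* Main.v *)
Require Import Defs.
From HB Require Import structures.
From mathcomp Require Import all_boot all_order all_algebra.
From mathcomp Require Import all_classical all_reals all_analysis.
From mathcomp Require Import ring lra.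

Set Implicit Arguments.
Unset Strict Implicit.
Unset Printing Implicit Defensive.

Import Order.TTheory GRing.Theory Num.Theory.
Import numFieldNormedType.Exports.
Local Open Scope classical_set_scope.
Local Open Scope ring_scope.

(** Necessity. If [h <= 0] on the network, then a solution satisfies [u'' >= c > 0]
    on every edge, so its derivative strictly increases along the edge and the
    two derivatives pointing into the edge from its ends have negative sum.
    Summed over all edges this contradicts the sum of the Kirchhoff conditions
    over all vertices (lemma [kw_necessary]).

    Sufficiency. Let [L] be the total length, and among the C^1 functions on the
    network let
    [J(v) = 1/2 \int v'^2 + c \int v] and [A(v) = \int h e^v].
    The energy [J] is minimized under the constraint [A(v) >= c L], which some
    [v] satisfies because [h] is positive somewhere ([kw_feasible]). By the
    Poincare inequality and the constraint, [J] controls both the Dirichlet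
    energy and the maximum of [|v|] ([kw_coercive]); hence a minimizing sequence
    [v_k] is bounded and equi-Hoelder, and it converges uniformly, along an
    ultrafilter, to a continuous function [u] ([ultra_arzela_ascoli]). Moreover
    [A(u) = c L], since otherwise subtracting a constant would lower the energy
    ([kw_limit_mass]).

    No Sobolev space and no weak derivative is needed to see that [u] is a
    strong solution. Because [A(u) = c L], the function [f = c - h e^u] has
    integral zero, so that the Poisson problem [w'' = f] with the Kirchhoff
    conditions has a solution [w] ([poisson], by linear algebra for the vertex
    values); it is normalized to agree with [u] at one vertex. The functions
    [v_k + t (w - v_k) + s] are eventually admissible, along the ultrafilter, when
    [A(u + t (w - u) + s) > c L].
    Green's formula for [w] expresses their energy without second derivatives
    of [v_k], and comparison with the infimum gives, in the limit in [k],
    [(t - t^2/2) (w - u)^2 <= C (t \int h e^u (w - u) + c L s)]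
    with a Poincare constant [C] ([kw_variation]). A shift
    [s = - t \int h e^u (w - u) / (c L) + O(t^2)] is enough for admissibility,
    so the right-hand side is [O(t^2)], and [t -> 0] forces [w = u]. Thus [u] is
    of class C^2 and solves the problem ([kw_metric_graph]).

    These arguments take place on an abstract metric graph. The embedded network
    is reduced to it as follows: topological connectedness gives combinatorial
    connectedness ([network_conn]), and since the inverse of an edge
    parametrization is continuous by compactness, the oriented derivatives at
    the vertices are one-sided derivatives in the parameter
    ([oriented_derivative_eq]). *)

(** * Calculus on the real line *)

Section Calculus.
Context {R : realType}.
Implicit Types (f g F : R -> R) (x y a b : R).

Lemma is_derive_addf f g y a b : is_derive y 1 f a -> is_derive y 1 g b ->
  is_derive y 1 (fun x => f x + g x) (a + b).
Proof. by move=> fa gb; exact: is_deriveD. Qed.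

Lemma is_derive_scalef f y a k : is_derive y 1 f a ->
  is_derive y 1 (fun x => k * f x) (k * a).
Proof. by move=> fa; exact: is_deriveZ. Qed.

Lemma is_derive_subf f g y a b : is_derive y 1 f a -> is_derive y 1 g b ->
  is_derive y 1 (fun x => f x - g x) (a - b).
Proof. by move=> fa gb; exact: is_deriveB. Qed.

Lemma is_derive_mulf f g y a b : is_derive y 1 f a -> is_derive y 1 g b ->
  is_derive y 1 (fun x => f x * g x) (f y * b + g y * a).
Proof. by move=> fa gb; exact: is_deriveM. Qed.

Lemma continuous_of_is_derive f g : (forall y, is_derive y 1 f (g y)) ->
  continuous f.
Proof.
move=> fg y; apply: differentiable_continuous.
by apply/derivable1_diffP; case: (fg y).
Qed.

Lemma is_derive_const_on f g a b (ab : a <= b) :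
  (forall y, y \in `]a, b[ -> is_derive y 1 f (g y)) ->
  {within `[a, b], continuous f} ->
  (forall y, y \in `]a, b[ -> g y = 0) -> f b = f a.
Proof.
move=> fg fc g0; move: ab; rewrite le_eqVlt => /predU1P[->//|ab].
have [c cab e] := MVT ab fg fc.
by apply/eqP; rewrite -subr_eq0 e g0// mul0r.
Qed.

(** The integral from a fixed base point gives a primitive on its right only. *)
Lemma primitive_right f : continuous f ->
  exists2 P, P 0 = 0 & forall x, -1 < x -> is_derive x 1 P (f x).
Proof.
move=> cf.
have [A dA] : exists A : R -> R, forall x, -1 < x ->
    derivable A x 1 /\ A^`()%classic x = f x.
  exists (fun x => (\int[lebesgue_measure]_(t in `[-1, x]) f t)%R) => x x1.
  apply: (@continuous_FTC1_closed _ f (-1) x (x + 1)) => //.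
  - by rewrite ltrDl.
  - apply: continuous_compact_integrable; first exact: segment_compact.
    exact: continuous_subspaceT.
  - exact: cf.
exists (fun x => A x - A 0); first by rewrite subrr.
move=> x /dA[dAx eAx]; rewrite -[f x]subr0; apply: is_derive_subf.
by rewrite -eAx derive1E; exact: derivableP.
Qed.

(** A primitive on the whole line, glued from [primitive_right] applied to [f]
    and to the reflection of [f]; both pieces are primitives on (-1, 1). *)
Lemma primitive_exists f : continuous f ->
  exists P, P 0 = 0 /\ forall x, is_derive x 1 P (f x).
Proof.
move=> cf.
have [A A0 dA] := primitive_right cf.
have cg : continuous (fun x => f (- x)).
  by move=> x; apply: continuous_comp; [exact: opp_continuous|exact: cf].
have [B B0 dB'] := primitive_right cg.
pose C x := - B (- x).
have dC x : x < 1 -> is_derive x 1 C (f x).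
  move=> x1; have dB : is_derive (- x) 1 B (f x).
    by have := dB' (- x); rewrite opprK; apply; rewrite ltrN2.
  have := is_derive1_comp dB (is_deriveNid x (1 : R)) => H.
  by have := is_deriveN H; rewrite mulrN1 opprK.
have AC x : -1 < x < 1 -> A x = C x.
  move=> /andP[x1 x2].
  have key a b : -1 < a -> b < 1 -> a <= b -> A b - C b = A a - C a.
    move=> a1 b1 ab; apply: (@is_derive_const_on (fun x => A x - C x)
      (fun x => f x - f x) a b ab).
    - move=> y; rewrite in_itv/= => /andP[ay yb].
      by apply: is_derive_subf; [apply: dA; lra|apply: dC; lra].
    - apply: derivable_within_continuous => y; rewrite in_itv/= => /andP[ay yb].
      have : is_derive y 1 (fun x => A x - C x) (f y - f y).
        by apply: is_derive_subf; [apply: dA; lra|apply: dC; lra].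
      by case.
    - by move=> y _; rewrite subrr.
  have z0 : A 0 - C 0 = 0 by rewrite A0 /C oppr0 B0 oppr0 subrr.
  apply/eqP; rewrite -subr_eq0; apply/eqP.
  have [x0|x0] := leP 0 x.
    by rewrite (key 0 x)//; lra.
  by rewrite -z0 (key x 0)//; lra.
pose P x := if - 2^-1 < x then A x else C x.
exists P; split; first by rewrite /P ifT// ; lra.
move=> x; have [x2|x2] := ltP (- 2^-1) x.
  apply: (@near_eq_is_derive _ _ _ A) => //.
    near=> z; rewrite /P ifT//; near: z; exact: lt_nbhsr.
  by apply: dA; lra.
apply: (@near_eq_is_derive _ _ _ C) => //.
  near=> z; rewrite /P; case: ifPn => // z2.
  apply/esym; apply: AC; apply/andP; split; first by lra.
  near: z; apply: lt_nbhsl; lra.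
by apply: dC; lra.
Unshelve. all: by end_near. Qed.

(** The primitive of a continuous function that vanishes at 0; thus
    [prim f b] is the integral of [f] from 0 to [b]. *)
Definition prim f : R -> R :=
  xget (fun=> 0) [set P | P 0 = 0 /\ forall x, is_derive x 1 P (f x)].

Lemma primP f : continuous f ->
  prim f 0 = 0 /\ forall x, is_derive x 1 (prim f) (f x).
Proof. by move=> /primitive_exists; exact: xgetPex. Qed.

Lemma prim0 f : continuous f -> prim f 0 = 0.
Proof. by move=> /primP[]. Qed.

Lemma is_derive_prim f x : continuous f -> is_derive x 1 (prim f) (f x).
Proof. by move=> /primP[]. Qed.

Lemma is_derive_eqB F G f a b : (forall x, is_derive x 1 F (f x)) ->
  (forall x, is_derive x 1 G (f x)) -> F b - F a = G b - G a.
Proof.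
move=> dF dG.
have dH x : is_derive x 1 (fun x => F x - G x) 0.
  by rewrite -(subrr (f x)); exact: is_derive_subf.
have := is_derive_0_is_cst a b dH; lra.
Qed.

Lemma primE f F b : continuous f -> (forall x, is_derive x 1 F (f x)) ->
  prim f b = F b - F 0.
Proof.
move=> cf dF; rewrite -(is_derive_eqB 0 b (fun x => is_derive_prim x cf) dF).
by rewrite prim0// subr0.
Qed.

Lemma continuousDf f g : continuous f -> continuous g ->
  continuous (fun x => f x + g x).
Proof. by move=> cf cg x; apply: cvgD; [exact: cf|exact: cg]. Qed.

Lemma continuousMf f g : continuous f -> continuous g ->
  continuous (fun x => f x * g x).
Proof. by move=> cf cg x; apply: cvgM; [exact: cf|exact: cg]. Qed.

Lemma continuousBf f g : continuous f -> continuous g ->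
  continuous (fun x => f x - g x).
Proof. by move=> cf cg x; apply: cvgB; [exact: cf|exact: cg]. Qed.

Lemma continuousZf k f : continuous f -> continuous (fun x => k * f x).
Proof. by move=> cf; apply: continuousMf => // x; exact: cvg_cst. Qed.

Lemma continuous_expRf f : continuous f -> continuous (fun x => expR (f x)).
Proof.
by move=> cf x; apply: continuous_comp; [exact: cf|exact: continuous_expR].
Qed.

Lemma primD f g b : continuous f -> continuous g ->
  prim (fun x => f x + g x) b = prim f b + prim g b.
Proof.
move=> cf cg; rewrite (primE b (continuousDf cf cg) (fun x =>
  is_derive_addf (is_derive_prim x cf) (is_derive_prim x cg))).
by rewrite !prim0// addr0 subr0.
Qed.

Lemma primZ k f b : continuous f ->
  prim (fun x => k * f x) b = k * prim f b.
Proof.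
move=> cf; rewrite (primE b (continuousZf (k := k) cf) (fun x =>
  is_derive_scalef k (is_derive_prim x cf))).
by rewrite prim0// mulr0 subr0.
Qed.

Lemma prim_cst k b : prim (fun=> k) b = k * b.
Proof.
have ck : continuous (fun _ : R => k) by move=> x; exact: cvg_cst.
have dk (x : R) : is_derive x 1 (fun x => k * x) k.
  by rewrite -{2}[k]mulr1; apply: is_derive_scalef; exact: is_derive_id.
by rewrite (primE b ck dk) mulr0 subr0.
Qed.

Lemma le_prim_sub f a b : continuous f -> a <= b ->
  (forall x, x \in `]a, b[ -> 0 <= f x) -> prim f a <= prim f b.
Proof.
move=> cf ab f0; move: ab; rewrite le_eqVlt => /predU1P[->//|ab].
have [c cab e] := MVT ab (fun x _ => is_derive_prim x cf)
  (continuous_subspaceT (continuous_of_is_derive (fun x => is_derive_prim x cf))).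
by rewrite -subr_ge0 e mulr_ge0 ?f0// subr_ge0 ltW.
Qed.

Lemma le_prim f g b : continuous f -> continuous g -> 0 <= b ->
  (forall x, x \in `[0, b] -> f x <= g x) -> prim f b <= prim g b.
Proof.
move=> cf cg b0 fg.
have cgf : continuous (fun x => g x + -1 * f x).
  by apply: continuousDf => //; exact: continuousZf.
have := @le_prim_sub _ 0 b cgf b0.
rewrite prim0// primD ?primZ//; last exact: continuousZf.
rewrite mulN1r subr_ge0; apply.
by move=> x /subset_itv_oo_cc/fg; lra.
Qed.

(** Cauchy-Schwarz for the integral of [f] on [[a, b]]. *)
Lemma sqr_prim_le f a b : continuous f -> a <= b ->
  (prim f b - prim f a) ^+ 2 <=
    (b - a) * (prim (fun x => f x ^+ 2) b - prim (fun x => f x ^+ 2) a).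
Proof.
move=> cf; rewrite le_eqVlt => /predU1P[->|ab].
  by rewrite !subrr expr0n mul0r.
have cf2 : continuous (fun x => f x ^+ 2) by exact: continuousMf.
set p := prim f b - prim f a; set q := prim _ b - prim _ a.
have ba : 0 < b - a by rewrite subr_gt0.
pose m := p / (b - a).
(* the mean value m of f minimizes the integral of (f - m)^2 *)
pose g x := (f x ^+ 2 + (- (2 * m)) * f x) + m ^+ 2.
have cg : continuous g.
  apply: continuousDf; last by move=> x; exact: cvg_cst.
  by apply: continuousDf => //; exact: continuousZf.
have gE c : prim g c = prim (fun x => f x ^+ 2) c - 2 * m * prim f c + m ^+ 2 * c.
  rewrite primD ?prim_cst//; last by move=> x; exact: cvg_cst.
    by rewrite primD// ?primZ ?mulNr//; exact: continuousZf.
  by apply: continuousDf => //; exact: continuousZf.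
have : prim g a <= prim g b.
  apply: le_prim_sub => //; first exact: ltW.
  by move=> x _; rewrite /g; have := sqr_ge0 (f x - m); lra.
rewrite !gE => H.
have {}H : 0 <= q - 2 * m * p + m ^+ 2 * (b - a) by rewrite /p /q; lra.
have pE : p = m * (b - a) by rewrite /m divfK// gt_eqF.
have : 0 <= (b - a) * (q - 2 * m * p + m ^+ 2 * (b - a)).
  by rewrite mulr_ge0// ltW.
rewrite pE; nra.
Qed.

End Calculus.

(** * Metric graphs *)

(** A finite connected metric graph: the edge [j] is a copy of the interval
    [[0, glen j]] whose end 0 is glued to the vertex [gsrc j] and whose end
    [glen j] is glued to [gtgt j]. Connectedness is stated as an induction
    principle: a property of vertices that propagates along edges in both
    directions and holds somewhere holds everywhere. *)
Record metric_graph (R : realType) := MetricGraph {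
  gvert : finType;
  gedge : finType;
  gsrc : gedge -> gvert;
  gtgt : gedge -> gvert;
  glen : gedge -> R;
  glen_gt0 : forall j, 0 < glen j;
  gconn : forall P : gvert -> Prop, (forall j, P (gsrc j) <-> P (gtgt j)) ->
    forall i0, P i0 -> forall i, P i
}.

Section MetricGraph.
Context {R : realType} (G : metric_graph R).
Local Notation V := (gvert G).
Local Notation E := (gedge G).
Local Notation len := (@glen R G).
Local Notation s := (@gsrc R G).
Local Notation t := (@gtgt R G).
Implicit Types (f g v dv w dw p dp : E -> R -> R) (a b : V -> R) (i : V) (j : E).

Lemma glen_ge0 j : 0 <= len j. Proof. exact/ltW/glen_gt0. Qed.

(** Continuity along each edge; the values at the vertices need not match. *)
Definition gcontinuous f := forall j, continuous (f j).

(** Functions of class C^1 on the graph: [dv] is the derivative of [v] along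
    the edges and [a] gives the values at the vertices. Functions on an edge
    are extended to the whole line so that all derivatives are two-sided. *)
Definition gC1 v dv a := [/\ forall j (y : R), is_derive y 1 (v j) (dv j y),
  gcontinuous dv & forall j, v j 0 = a (s j) /\ v j (len j) = a (t j)].

(** Kirchhoff condition on a derivative [dw]: at each vertex the sum of the
    derivatives pointing into the edges vanishes. *)
Definition kirchhoff dw := forall i,
  \sum_(j | s j == i) dw j 0 = \sum_(j | t j == i) dw j (len j).

(** The integral of [f] over the graph. *)
Definition gint f : R := \sum_j prim (f j) (len j).

(** The total length of the graph. *)
Definition glength : R := \sum_j len j.

Lemma gcontinuousD f g : gcontinuous f -> gcontinuous g ->
  gcontinuous (fun j y => f j y + g j y).
Proof. by move=> cf cg j; exact: continuousDf. Qed.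

Lemma gcontinuousB f g : gcontinuous f -> gcontinuous g ->
  gcontinuous (fun j y => f j y - g j y).
Proof. by move=> cf cg j; exact: continuousBf. Qed.

Lemma gcontinuousM f g : gcontinuous f -> gcontinuous g ->
  gcontinuous (fun j y => f j y * g j y).
Proof. by move=> cf cg j; exact: continuousMf. Qed.

Lemma gcontinuousZ k f : gcontinuous f -> gcontinuous (fun j y => k * f j y).
Proof. by move=> cf j; exact: continuousZf. Qed.

Lemma gcontinuousX2 f : gcontinuous f -> gcontinuous (fun j y => f j y ^+ 2).
Proof. by move=> cf; exact: gcontinuousM. Qed.

Lemma gcontinuous_cst k : gcontinuous (fun _ _ => k).
Proof. by move=> j x; exact: cvg_cst. Qed.

Lemma gcontinuous_expR f : gcontinuous f ->
  gcontinuous (fun j y => expR (f j y)).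
Proof. by move=> cf j; exact: continuous_expRf. Qed.

Lemma gC1_continuous v dv a : gC1 v dv a -> gcontinuous v.
Proof. by move=> [vd _ _] j; exact: continuous_of_is_derive (vd j). Qed.

Lemma gintD f g : gcontinuous f -> gcontinuous g ->
  gint (fun j y => f j y + g j y) = gint f + gint g.
Proof.
by move=> cf cg; rewrite -big_split; apply: eq_bigr => j _; exact: primD.
Qed.

Lemma gintZ k f : gcontinuous f -> gint (fun j y => k * f j y) = k * gint f.
Proof.
by move=> cf; rewrite /gint mulr_sumr; apply: eq_bigr => j _; exact: primZ.
Qed.

Lemma gintB f g : gcontinuous f -> gcontinuous g ->
  gint (fun j y => f j y - g j y) = gint f - gint g.
Proof.
move=> cf cg; rewrite -mulN1r -gintZ// -gintD//; last exact: gcontinuousZ.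
by congr gint; apply/funext => j; apply/funext => y; rewrite mulN1r.
Qed.

Lemma gint_cst k : gint (fun _ _ => k) = k * glength.
Proof. by rewrite mulr_sumr; apply: eq_bigr => j _; exact: prim_cst. Qed.

Lemma le_gint f g : gcontinuous f -> gcontinuous g ->
  (forall j y, y \in `[0, len j] -> f j y <= g j y) -> gint f <= gint g.
Proof.
move=> cf cg fg; apply: ler_sum => j _.
by apply: le_prim => //; [exact: glen_ge0|exact: fg].
Qed.

Lemma gint_ge0 f : gcontinuous f -> (forall j y, 0 <= f j y) -> 0 <= gint f.
Proof.
move=> cf f0; rewrite -[leLHS](mul0r glength) -gint_cst.
by apply: le_gint => //; exact: gcontinuous_cst.
Qed.

Lemma ler_norm_gint_sub f g e : gcontinuous f -> gcontinuous g ->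
  (forall j y, y \in `[0, len j] -> `|f j y - g j y| <= e) ->
  `|gint f - gint g| <= e * glength.
Proof.
move=> cf cg fg; rewrite -gintB// -gint_cst ler_norml.
have cfg := gcontinuousB cf cg; have ce := @gcontinuous_cst e.
rewrite -mulN1r -gintZ//; apply/andP; split; apply: le_gint => //.
- exact: gcontinuousZ.
- by move=> j y /fg; rewrite ler_norml mulN1r => /andP[].
- by move=> j y /fg; rewrite ler_norml => /andP[].
Qed.

(** A continuous function is bounded on the graph. *)
Lemma gcontinuous_bounded f : gcontinuous f ->
  exists2 B, 0 < B & forall j y, y \in `[0, len j] -> `|f j y| <= B.
Proof.
move=> cf.
have /choice[B HB] j : exists B, forall y, y \in `[0, len j] -> `|f j y| <= B.
  have cn : {within `[0, len j], continuous (fun y => `|f j y|)}.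
    apply: continuous_subspaceT => y; apply: continuous_comp; first exact: cf.
    exact: norm_continuous.
  by have [x _ xB] := EVT_max (glen_ge0 j) cn; exists `|f j x|.
exists (1 + \sum_j `|B j|); first by rewrite ltr_pwDl// sumr_ge0.
move=> j y /HB/le_trans; apply; rewrite (bigD1 j)//= addrCA.
by rewrite (le_trans (ler_norm _))// lerDl addr_ge0// sumr_ge0.
Qed.

Lemma glength_ge_len j : len j <= glength.
Proof.
by rewrite /glength (bigD1 j)//= lerDl sumr_ge0// => k _; exact: glen_ge0.
Qed.

Lemma glength_gt0 j : 0 < glength.
Proof. exact: lt_le_trans (glen_gt0 j) (glength_ge_len j). Qed.

(** Green's formula; the boundary terms cancel by the Kirchhoff condition. *)
Lemma green w f dp p b : gC1 p dp b -> gcontinuous f ->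
  (forall j (y : R), is_derive y 1 (w j) (f j y)) -> kirchhoff w ->
  gint (fun j y => w j y * dp j y) = - gint (fun j y => f j y * p j y).
Proof.
move=> Cp cf dw kw; have cp := gC1_continuous Cp; case: Cp => dpp cdp pb.
have cw : gcontinuous w by move=> j; exact: continuous_of_is_derive (dw j).
apply/eqP; rewrite -subr_eq0 opprK -gintD; [|exact: gcontinuousM..].
have -> : gint (fun j y => w j y * dp j y + f j y * p j y) =
    \sum_j (w j (len j) * b (t j) - w j 0 * b (s j)).
  apply: eq_bigr => j _; case: (pb j) => <- <-.
  have dwp y := is_derive_mulf (dw j y) (dpp j y).
  rewrite -(primE (len j) _ dwp).
    by congr prim; apply/funext => y; rewrite [p j y * _]mulrC.
  by apply: continuousDf; apply: continuousMf.
rewrite sumrB subr_eq0 (partition_big t xpredT)//=.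
rewrite [in eqbRHS](partition_big s xpredT)//=; apply/eqP/eq_bigr => i _.
transitivity ((\sum_(j | t j == i) w j (len j)) * b i).
  by rewrite mulr_suml; apply: eq_bigr => j /eqP ->.
by rewrite -kw mulr_suml; apply: eq_bigr => j /eqP ->.
Qed.

(** Vertex values are controlled by the increments along the edges. *)
Lemma vertex_increment i0 : exists2 N : R, 0 <= N &
  forall a i, `|a i - a i0| <= N * \sum_j `|a (t j) - a (s j)|.
Proof.
have inc_ge0 a : 0 <= \sum_j `|a (t j) - a (s j)| by rewrite sumr_ge0.
have inc1 a j : `|a (t j) - a (s j)| <= \sum_j `|a (t j) - a (s j)|.
  by rewrite (bigD1 j)//= lerDl sumr_ge0.
pose P i := exists N : R,
  forall a, `|a i - a i0| <= N * \sum_j `|a (t j) - a (s j)|.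
have Pi i : P i.
  apply: (@gconn _ G P _ i0) => [j|]; last first.
    by exists 0 => a; rewrite subrr normr0 mul0r.
  split=> -[N HN]; exists (N + 1) => a; rewrite mulrDl mul1r.
    rewrite (le_trans (ler_distD (a (s j)) _ _))// addrC lerD//.
  by rewrite (le_trans (ler_distD (a (t j)) _ _))// addrC lerD// distrC.
have [N HN] := choice Pi.
exists (\sum_i `|N i|); first by rewrite sumr_ge0.
move=> a i; rewrite (le_trans (HN i a))// ler_wpM2r//.
by rewrite (bigD1 i)//= (le_trans (ler_norm _))// lerDl sumr_ge0.
Qed.

Lemma prim_sqr_le_gint f j (y z : R) : gcontinuous f -> 0 <= y -> y <= z ->
  z <= len j ->
  prim (fun x => f j x ^+ 2) z - prim (fun x => f j x ^+ 2) y <=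
    gint (fun j y => f j y ^+ 2).
Proof.
move=> cf y0 yz zl; have cf2 := gcontinuousX2 cf.
have mono (x1 x2 : R) : x1 <= x2 ->
    prim (fun x => f j x ^+ 2) x1 <= prim (fun x => f j x ^+ 2) x2.
  by move=> uv; apply: le_prim_sub; [exact: cf2|by []|move=> x _; exact: sqr_ge0].
rewrite /gint (bigD1 j)//= -[leLHS]addr0 lerD//.
  have p0 := prim0 (cf2 j).
  by rewrite -[leRHS]subr0 -p0 lerB// mono.
apply: sumr_ge0 => k _; rewrite -(prim0 (cf2 k)).
by apply: le_prim_sub; [exact: cf2|exact: glen_ge0|move=> x _; exact: sqr_ge0].
Qed.

(** A C^1 function is Hoelder continuous of exponent 1/2 along each edge, with
    a constant that depends only on its Dirichlet energy. *)
Lemma gC1_hoelder v dv a j (y z : R) : gC1 v dv a ->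
  y \in `[0, len j] -> z \in `[0, len j] ->
  (v j z - v j y) ^+ 2 <= `|z - y| * gint (fun j y => dv j y ^+ 2).
Proof.
move=> [dvv cdv va].
wlog yz : y z / y <= z.
  have [yz H yl zl|/ltW zy H yl zl] := leP y z; first exact: H.
  by rewrite -sqrrN opprB distrC H.
rewrite !in_itv/= => /andP[y0 yl] /andP[z0 zl].
rewrite ger0_norm ?subr_ge0//.
have cd := cdv j.
have -> : v j z - v j y = prim (dv j) z - prim (dv j) y.
  by rewrite !(primE _ cd (dvv j)); lra.
rewrite (le_trans (sqr_prim_le cd yz))// ler_wpM2l ?subr_ge0//.
exact: prim_sqr_le_gint.
Qed.

(** Poincare inequality. *)
Lemma poincare i0 : exists2 C : R, 0 < C &
  forall v dv a, gC1 v dv a -> forall j y, y \in `[0, len j] ->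
    (v j y - a i0) ^+ 2 <= C * gint (fun j y => dv j y ^+ 2).
Proof.
have [N N0 HN] := vertex_increment i0.
have L0 : 0 <= glength by rewrite sumr_ge0// => j _; exact: glen_ge0.
exists ((1 + N * #|E|%:R) ^+ 2 * glength + 1).
  by rewrite ltr_wpDl// mulr_ge0// sqr_ge0.
move=> v dv a Cv j y yl; set D := gint _.
have D0 : 0 <= D.
  apply: gint_ge0 => [|k z]; last exact: sqr_ge0.
  by case: Cv => _ cdv _; exact: gcontinuousX2.
pose r := Num.sqrt (glength * D).
have r0 : 0 <= r by exact: sqrtr_ge0.
have r2 : r ^+ 2 = glength * D by rewrite sqr_sqrtr// mulr_ge0.
have hol k y1 y2 : y1 \in `[0, len k] -> y2 \in `[0, len k] ->
    `|v k y2 - v k y1| <= r.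
  move=> y1l y2l; rewrite -(@ler_pXn2r _ 2)// ?nnegrE//.
  rewrite real_normK ?num_real// r2 (le_trans (gC1_hoelder Cv y1l y2l))//.
  rewrite ler_wpM2r// (le_trans _ (glength_ge_len k))//.
  move: y1l y2l; rewrite !in_itv/= => /andP[? ?] /andP[? ?].
  by rewrite ler_norml; apply/andP; split; lra.
have in0 k : 0 \in `[0, len k] by rewrite in_itv/= lexx glen_ge0.
have inl k : len k \in `[0, len k] by rewrite in_itv/= lexx glen_ge0.
have [_ _ va] := Cv.
have H : `|v j y - a i0| <= (1 + N * #|E|%:R) * r.
  rewrite mulrDl mul1r (le_trans (ler_distD (a (s j)) _ _))//.
  rewrite lerD//; first by rewrite -(va j).1 hol.
  rewrite (le_trans (HN a (s j)))// -mulrA ler_wpM2l//.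
  rewrite mulr_natl -sumr_const ler_sum// => k _.
  by rewrite -(va k).1 -(va k).2 hol.
rewrite -real_normK ?num_real//.
have -> : ((1 + N * #|E|%:R) ^+ 2 * glength + 1) * D =
    ((1 + N * #|E|%:R) * r) ^+ 2 + D by rewrite exprMn r2; ring.
rewrite (@le_trans _ _ (((1 + N * #|E|%:R) * r) ^+ 2))// ?lerDl//.
by rewrite lerXn2r// ?nnegrE// mulr_ge0// addr_ge0// mulr_ge0.
Qed.

(** The weighted graph Laplacian reaches every vertex function of zero sum:
    its cokernel is spanned by constants, because the energy form
    [\sum_j (a (t j) - a (s j)) ^+ 2 / len j] vanishes only on constants. *)
Lemma graph_laplacian_surj (b : V -> R) : \sum_i b i = 0 ->
  exists a, forall i,
    \sum_(j | t j == i) (a (t j) - a (s j)) / len j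
      - \sum_(j | s j == i) (a (t j) - a (s j)) / len j = b i.
Proof.
move=> b0.
pose B : 'M[R]_(#|V|, #|E|) := \matrix_(p, q)
  ((enum_val p == t (enum_val q))%:R - (enum_val p == s (enum_val q))%:R).
pose D : 'M[R]_(#|E|) := diag_mx (\row_q (len (enum_val q))^-1).
have sumV (F : V -> R) : \sum_(p < #|V|) F (enum_val p) = \sum_i F i.
  by rewrite [RHS](reindex _ (onW_bij _ (enum_val_bij V))).
have sumE (F : E -> R) : \sum_(q < #|E|) F (enum_val q) = \sum_j F j.
  by rewrite [RHS](reindex _ (onW_bij _ (enum_val_bij E))).
have sum1 (F : V -> R) i : \sum_k F k * (k == i)%:R = F i.
  rewrite (bigD1 i)//= eqxx mulr1 big1 ?addr0// => k /negPf ->.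
  by rewrite mulr0.
have BE m (x : 'M[R]_(m, #|V|)) r q : (x *m B) r q =
    x r (enum_rank (t (enum_val q))) - x r (enum_rank (s (enum_val q))).
  rewrite mxE; under eq_bigr do rewrite mxE mulrBr.
  rewrite sumrB; congr (_ - _).
    rewrite -[RHS](sum1 (fun i => x r (enum_rank i))) -sumV.
    by apply: eq_bigr => p _; rewrite enum_valK.
  rewrite -[RHS](sum1 (fun i => x r (enum_rank i))) -sumV.
  by apply: eq_bigr => p _; rewrite enum_valK.
pose K := B *m D *m B^T.
pose beta : 'rV[R]_(#|V|) := \row_p b (enum_val p).
have : (beta <= K)%MS.
  rewrite submxE; move: (mulmx_coker K); move: (cokermx K) => C KC.
  have CB : C^T *m B = 0.
    have /matrixP Z : (C^T *m B) *m D *m (C^T *m B)^T = 0.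
      have KC' : B *m (D *m (B^T *m C)) = 0.
        by rewrite !mulmxA.
      by rewrite [X in _ *m X = _]trmx_mul trmxK -!mulmxA KC' mulmx0.
    apply/matrixP => r q; rewrite mxE.
    have /eqP := Z r r; rewrite mxE [in eqbRHS]mxE.
    under eq_bigr do rewrite mul_mx_diag mxE [X in _ * X]mxE mxE.
    rewrite psumr_eq0; last first.
      move=> k _; rewrite mulrAC -expr2 mulr_ge0 ?sqr_ge0//.
      by rewrite mxE invr_ge0 glen_ge0.
    move=> /allP/(_ q); rewrite mem_index_enum => /(_ isT)/eqP/eqP.
    rewrite [(\row__ _) 0 q]mxE !mulf_eq0 invr_eq0 (gt_eqF (glen_gt0 _)) orbF orbb.
    by move/eqP ->; rewrite mxE.
  have Cedge r j : C (enum_rank (t j)) r = C (enum_rank (s j)) r.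
    have /matrixP/(_ r (enum_rank j)) := CB.
    by rewrite BE !mxE enum_rankK => /eqP; rewrite subr_eq0 => /eqP.
  apply/eqP/matrixP => o r; rewrite mxE [RHS]mxE.
  have [i0|noV] := pickP (fun _ : V => true); last first.
    by rewrite big1// => p _; have := noV (enum_val p).
  have Cc i : C (enum_rank i) r = C (enum_rank i0) r.
    apply: (@gconn _ G (fun i => C (enum_rank i) r = C (enum_rank i0) r) _ i0)
      => // j.
    by rewrite Cedge.
  transitivity ((\sum_i b i) * C (enum_rank i0) r); last by rewrite b0 mul0r.
  rewrite -sumV mulr_suml; apply: eq_bigr => p _.
  by rewrite mxE -(Cc (enum_val p)) enum_valK.
move=> /submxP[x xK]; exists (fun i => x 0 (enum_rank i)) => i.
have /matrixP/(_ 0 (enum_rank i)) := xK.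
rewrite mxE enum_rankK => ->.
rewrite /K !mulmxA mxE.
under [RHS]eq_bigr do rewrite mul_mx_diag mxE BE !mxE enum_rankK.
rewrite (sumE (fun j => (x 0 (enum_rank (t j)) - x 0 (enum_rank (s j)))
   * (len j)^-1 * ((i == t j)%:R - (i == s j)%:R))).
under [RHS]eq_bigr do rewrite mulrBr.
rewrite sumrB; congr (_ - _).
  rewrite big_mkcond/=; apply: eq_bigr => j _.
  by rewrite eq_sym; case: eqP => _; rewrite ?mulr1 ?mulr0.
rewrite big_mkcond/=; apply: eq_bigr => j _.
by rewrite eq_sym; case: eqP => _; rewrite ?mulr1 ?mulr0.
Qed.

(** The Poisson problem with Kirchhoff conditions is solvable when the right
    hand side has zero mean; the value at one vertex can be prescribed. *)
Lemma poisson f (i0 : V) (k : R) : gcontinuous f -> gint f = 0 ->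
  exists w dw a, [/\ gC1 w dw a, forall j (y : R), is_derive y 1 (dw j) (f j y),
    kirchhoff dw & a i0 = k].
Proof.
move=> cf f0.
pose P1 j := prim (f j); have dP1 j (y : R) : is_derive y 1 (P1 j) (f j y).
  exact: is_derive_prim (cf j).
have cP1 j : continuous (P1 j) by exact: continuous_of_is_derive (dP1 j).
pose P2 j := prim (P1 j); have dP2 j (y : R) : is_derive y 1 (P2 j) (P1 j y).
  exact: is_derive_prim (cP1 j).
have P10 j : P1 j 0 = 0 by exact: prim0.
have P20 j : P2 j 0 = 0 by exact: prim0.
pose F j := P2 j (len j) / len j.
pose b i := \sum_(j | t j == i) (F j - P1 j (len j)) - \sum_(j | s j == i) F j.
have b0 : \sum_i b i = 0.
  have tot (g : E -> V) (H : E -> R) : \sum_i \sum_(j | g j == i) H j = \sum_j H j.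
    by rewrite [RHS](partition_big g xpredT).
  by rewrite /b sumrB !tot sumrB -/(gint f) f0 subr0 subrr.
have [a aE] := graph_laplacian_surj b0.
pose m j := (a (t j) - a (s j)) / len j - F j.
pose w j y := (a (s j) + (k - a i0)) + m j * y + P2 j y.
pose dw j y := m j + P1 j y.
exists w, dw, (fun i => a i + (k - a i0)); split.
- split.
  + move=> j y; rewrite /w /dw; apply: is_derive_addf => //.
    have dm : is_derive y 1 (fun y => m j * y) (m j * 1).
      by apply: is_derive_scalef; exact: is_derive_id.
    have := is_derive_addf (is_derive_cst (a (s j) + (k - a i0)) y 1) dm.
    by rewrite add0r mulr1.
  + by move=> j; apply: continuousDf => // y; exact: cvg_cst.
  + move=> j; rewrite /w P20 mulr0 !addr0; split=> //.
    rewrite /m /F mulrBl !divfK ?gt_eqF ?glen_gt0//; lra.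
- move=> j y; have := is_derive_addf (is_derive_cst (m j) y 1) (dP1 j y).
  by rewrite add0r.
- move=> i; rewrite /dw /m; under eq_bigr do rewrite P10 addr0.
  have := aE i; rewrite /b !(sumrB, big_split)/=; lra.
- by rewrite addrC subrK.
Qed.

End MetricGraph.

(** * Compactness along an ultrafilter *)

Section UltraLimits.
Context {R : realType} (U : set_system nat) {UU : UltraFilter U}.

Lemma ultra_cvg_bounded (u : nat -> R) (B : R) : (forall k, `|u k| <= B) ->
  exists p : R, u k @[k --> U] --> p.
Proof.
move=> uB; have UB : (u @ U) `[- B, B]%classic.
  by apply: (@filterE _ U) => k /=; rewrite in_itv/= -ler_norml; exact: uB.
have [p [_ clp]] := @segment_compact R (- B) B (u @ U) _ UB.
exists p => A pA.
have [//|nA] := @in_ultra_setVsetC _ U (u @^-1` A) _.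
by have [q []] := clp (~` A) A nA pA.
Qed.

Lemma ler_norm_sqr (x e : R) : 0 <= e -> x ^+ 2 <= e ^+ 2 -> `|x| <= e.
Proof. by move=> e0 xe; rewrite ler_norml; apply/andP; split; nra. Qed.

Lemma hoelder_near (g : R -> R) (K : R) : 0 <= K ->
  (forall x y, (g x - g y) ^+ 2 <= K * `|x - y|) ->
  forall x e, 0 < e -> \forall y \near x, `|g x - g y| <= e.
Proof.
move=> K0 gK x e e0; near=> y.
apply: ler_norm_sqr; first exact: ltW.
rewrite (le_trans (gK x y))//.
have H : `|x - y| < e ^+ 2 / (K + 1).
  near: y; apply: nbhsx_ballx; rewrite divr_gt0 ?exprn_gt0// ltr_wpDl//.
rewrite ltr_pdivlMr in H; last by rewrite ltr_wpDl.
rewrite (le_trans _ (ltW H))// mulrC ler_wpM2l// lerDl.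
Unshelve. all: by end_near. Qed.

(** A bounded equi-Hoelder sequence on [[0, l]] converges uniformly along an
    ultrafilter; the limit is extended to a continuous function on the line. *)
Lemma ultra_arzela_ascoli (f : nat -> R -> R) (l B K : R) : 0 <= l -> 0 <= K ->
  (forall k y, y \in `[0, l] -> `|f k y| <= B) ->
  (forall k y z, y \in `[0, l] -> z \in `[0, l] ->
     (f k z - f k y) ^+ 2 <= K * `|z - y|) ->
  exists2 g : R -> R, continuous g & forall e, 0 < e ->
    \forall k \near U, forall y, y \in `[0, l] -> `|f k y - g y| <= e.
Proof.
move=> l0 K0 fB fK.
pose cl (y : R) := Num.max 0 (Num.min y l).
have clin y : cl y \in `[0, l].
  by rewrite in_itv/= /cl le_max lexx ge_max l0 ge_min lexx orbT.
have clid y : y \in `[0, l] -> cl y = y.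
  by rewrite in_itv/= /cl => /andP[? ?]; rewrite min_l// max_r.
have cl1 y z : `|cl y - cl z| <= `|y - z|.
  wlog yz : y z / z <= y.
    by move=> H; case: (leP z y) => [/H//|/ltW/H]; rewrite distrC [leRHS]distrC.
  rewrite (ger0_norm (_ : 0 <= y - z)) ?subr_ge0// /cl.
  case: (leP y l) => ?; case: (leP z l) => ?; rewrite ?(max_r l0);
    case: (leP 0 y) => ?; case: (leP 0 z) => ?;
    rewrite ler_norml; apply/andP; split; lra.
pose F k y := f k (cl y).
have FB k y : `|F k y| <= B by exact: fB.
have FK k y z : (F k z - F k y) ^+ 2 <= K * `|z - y|.
  by rewrite (le_trans (fK _ _ _ _ _))// ler_wpM2l.
have /choice[g gP] y : exists p : R, F k y @[k --> U] --> p.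
  by apply: (@ultra_cvg_bounded _ B).
have gK y z : (g z - g y) ^+ 2 <= K * `|z - y|.
  apply: (@closed_cvg _ R U _ (fun k => (F k z - F k y) ^+ 2)
    (fun x => x <= K * `|z - y|)).
  - exact: closed_le.
  - by apply: filterE => k; exact: FK.
  - by apply: cvgM; apply: cvgB; exact: gP.
exists g.
  move=> x; apply/cvgrPdist_le => e e0.
  exact: (hoelder_near K0 (fun x y => gK y x)).
move=> e e0.
have e3 : 0 < e / 3 by rewrite divr_gt0.
have /compact_near_coveringP := @segment_compact R 0 l.
move=> /(_ _ U (fun k y => `|F k y - g y| <= e)) H.
have {}H : \forall k \near U, `[0, l] `<=` (fun y => `|F k y - g y| <= e).
  apply: H => x _.
  have FX k : forall y, `|x - y| < (e / 3) ^+ 2 / (K + 1) -> `|F k x - F k y| <= e / 3.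
    move=> y; rewrite ltr_pdivlMr; last by rewrite ltr_wpDl.
    move=> h; apply: ler_norm_sqr; first exact: ltW.
    rewrite (le_trans (FK k y x))// (le_trans _ (ltW h))// mulrC ler_wpM2l// lerDl.
    exact: ler01.
  near=> y k => /=.
  have h1 : `|F k x - F k y| <= e / 3.
    apply: FX; near: y.
    apply: nbhsx_ballx; rewrite divr_gt0 ?exprn_gt0// ltr_wpDl//.
  have h2 : `|g x - g y| <= e / 3.
    by near: y; exact: (hoelder_near K0 (fun x y => gK y x)).
  have h3 : `|g x - F k x| <= e / 3.
    near: k; by have /cvgrPdist_le/(_ _ e3) := gP x.
  move: h1 h2 h3; rewrite !ler_norml => /andP[? ?] /andP[? ?] /andP[? ?].
  by apply/andP; split; lra.
apply: filterS H => k Hk y yl; have := Hk y yl => /=.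
by rewrite /F clid.
Unshelve. all: by end_near. Qed.

End UltraLimits.

(** * Exponential estimates and bump functions *)

Section ExpBounds.
Context {R : realType}.
Implicit Types x y B : R.

Lemma expR_lipschitz x y B : x <= B -> y <= B ->
  `|expR x - expR y| <= expR B * `|x - y|.
Proof.
wlog yx : x y / y <= x.
  move=> H xB yB; case: (leP y x) => [yx|/ltW xy]; first exact: H.
  by rewrite distrC [in leRHS]distrC H.
move=> xB yB.
rewrite !ger0_norm ?subr_ge0 ?ler_expR//.
rewrite (@le_trans _ _ (expR x * (x - y)))//; last first.
  by rewrite ler_wpM2r ?subr_ge0// ler_expR.
have := expR_ge1Dx (y - x) => H.
have : expR x * (1 + (y - x)) <= expR x * expR (y - x).
  by rewrite ler_wpM2l// expR_ge0.
by rewrite -expRD subrKC; lra.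
Qed.

Lemma expR_quadratic_le x : `|x| <= 2^-1 -> expR x <= 1 + x + 2 * x ^+ 2.
Proof.
rewrite ler_norml => /andP[x1 x2].
have e0 := expR_gt0 x; have := expR_ge1Dx (- x); rewrite expRN => H.
have {}H : (1 - x) * expR x <= 1.
  by rewrite -(ler_pM2r e0) mulVf ?gt_eqF// in H.
have P : 0 <= x ^+ 2 * (1 - 2 * x).
  by rewrite mulr_ge0 ?sqr_ge0//; lra.
rewrite -(@ler_pM2l _ (1 - x)); last by lra.
rewrite (le_trans H)//.
have -> : (1 - x) * (1 + x + 2 * x ^+ 2) = 1 + x ^+ 2 * (1 - 2 * x) by ring.
by rewrite lerDl.
Qed.

Lemma expR_quadratic x : `|x| <= 2^-1 -> `|expR x - 1 - x| <= 2 * x ^+ 2.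
Proof.
move=> x2; rewrite ler_norml; apply/andP; split.
  by have := expR_ge1Dx x; have := sqr_ge0 x; lra.
by have := expR_quadratic_le x2; lra.
Qed.

End ExpBounds.

Section Bump.
Context {R : realType}.

(** Strict positivity of the integral of a nonnegative continuous function. *)
Lemma prim_gt0 (f : R -> R) (l y : R) : continuous f ->
  (forall x, x \in `[0, l] -> 0 <= f x) -> y \in `]0, l[ -> 0 < f y ->
  0 < prim f l.
Proof.
move=> cf f0 + fy; rewrite in_itv/= => /andP[y0 yl].
have mono (a b : R) : 0 <= a -> a <= b -> b <= l -> prim f a <= prim f b.
  move=> a0' ab bl; apply: le_prim_sub => // x; rewrite in_itv/= => /andP[? ?].
  by apply: f0; rewrite in_itv/=; apply/andP; split; lra.
have p0 := prim0 cf.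
have l0 : 0 <= prim f l.
  by have := mono 0 l (lexx 0) (ltW (lt_trans y0 yl)) (lexx l); rewrite p0.
rewrite lt_neqAle l0 andbT; apply/eqP => pl.
have near0 : \forall x \near y, cst 0 x = prim f x.
  near=> x; have x0 : 0 < x by near: x; exact: lt_nbhsr.
  have xl : x < l by near: x; exact: lt_nbhsl.
  have := mono x l (ltW x0) (ltW xl) (lexx l).
  have := mono 0 x (lexx 0) (ltW x0) (ltW xl).
  by rewrite p0 -pl => ? ?; apply/eqP; rewrite eq_le /=; apply/andP.
have d0 : is_derive y 1 (prim f) 0.
  by apply: near_eq_is_derive; first exact: near0; exact: is_derive_cst.
have [_ e1] := d0; have [_ e2] := is_derive_prim y cf.
by move: fy; rewrite -e2 e1 ltxx.
Unshelve. all: by end_near. Qed.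

(** A C^1 bump: nonnegative, positive at [y], vanishing off [[y - r, y + r]]. *)
Lemma bump (y r : R) : 0 < r -> exists b db : R -> R,
  [/\ forall x : R, is_derive x 1 b (db x), continuous db, forall x, 0 <= b x,
      0 < b y & forall x, r <= `|x - y| -> b x = 0].
Proof.
move=> r0; pose q (x : R) := 2 * Num.max 0 x.
have cq : continuous q.
  apply: continuousZf => x; apply: continuous_max => //; exact: cvg_cst.
have q0 x : 0 <= q x by rewrite mulr_ge0// le_max lexx.
pose Q := prim q.
have Qneg x : x <= 0 -> Q x = 0.
  move=> x0; rewrite -(prim0 cq); apply/esym.
  apply: (is_derive_const_on x0 (fun z _ => is_derive_prim z cq)).
    apply: continuous_subspaceT.
    exact: continuous_of_is_derive (fun z => is_derive_prim z cq).
  by move=> z; rewrite in_itv/= => /andP[_ z0]; rewrite /q max_l ?mulr0// ltW.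
have Qge0 x : 0 <= Q x.
  have [x0|/ltW/Qneg->//] := leP 0 x.
  by rewrite -(prim0 cq); apply: le_prim_sub.
pose g (x : R) := r ^+ 2 - (x - y) * (x - y).
have dg (x : R) : is_derive x 1 g (- ((x - y) + (x - y))).
  have d1 : is_derive x 1 (fun z => z - y) (1 - 0).
    exact: is_derive_subf.
  have d2 := is_derive_mulf d1 d1.
  have := is_derive_subf (is_derive_cst (r ^+ 2) x 1) d2.
  by rewrite subr0 !mulr1 sub0r.
have cg : continuous g by exact: continuous_of_is_derive dg.
exists (Q \o g), (fun x => q (g x) * - ((x - y) + (x - y))); split.
- by move=> x; apply: is_derive1_comp => //; exact: is_derive_prim.
- apply: continuousMf => x.
    by apply: continuous_comp; [exact: cg|exact: cq].
  by apply: cvgN; apply: cvgD; apply: cvgB => //; exact: cvg_cst.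
- by move=> x; exact: Qge0.
- rewrite /= /g subrr mulr0 subr0; apply: (@prim_gt0 _ _ (r ^+ 2 / 2)) => //.
    by rewrite in_itv/=; have := exprn_gt0 2 r0 => ?; apply/andP; split; lra.
  rewrite mulr_gt0// lt_max divr_gt0 ?orbT// exprn_gt0//.
- move=> x rx; apply: Qneg; rewrite /g subr_le0 -expr2 -(real_normK (num_real (x - y))).
  by rewrite lerXn2r// ?nnegrE// ltW.
Qed.

End Bump.

(** * The variational problem *)

Section KazdanWarner.
Context {R : realType} (G : metric_graph R).
Local Notation E := (gedge G).
Local Notation len := (@glen R G).
Local Notation L := (glength G).
Context (h : E -> R -> R) (c : R) (hc : gcontinuous h) (c0 : 0 < c) (j0 : E).
Implicit Types (v dv w dw u : E -> R -> R) (a : gvert G -> R).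

(** The Dirichlet energy of a function with derivative [dv], up to a factor. *)
Definition dirichlet dv : R := gint (fun j y => dv j y ^+ 2).

(** The energy to be minimized, under the constraint [tau <= kw_mass v]. *)
Definition kw_energy v dv : R := 2^-1 * dirichlet dv + c * gint v.

(** The integral of [h e^v]; it equals [tau] for every solution [v]. *)
Definition kw_mass v : R := gint (fun j y => h j y * expR (v j y)).

Local Notation tau := (c * L).
Local Notation base := (gsrc j0).

Let L0 : 0 < L. Proof. exact: glength_gt0 j0. Qed.
Let tau0 : 0 < tau. Proof. exact: mulr_gt0. Qed.

(** Uniform convergence on the graph of [p] to [q] along the filter [U]. *)
Definition gunif (U : set_system nat) (p : nat -> E -> R -> R)
    (q : E -> R -> R) :=
  forall e, 0 < e -> \forall k \near U,
    forall j y, y \in `[0, len j] -> `|p k j y - q j y| <= e.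

Lemma dirichlet_ge0 dv : gcontinuous dv -> 0 <= dirichlet dv.
Proof.
move=> cdv; apply: gint_ge0 => [|j y]; last exact: sqr_ge0.
exact: gcontinuousX2.
Qed.

Lemma gcontinuous_mass v : gcontinuous v ->
  gcontinuous (fun j y => h j y * expR (v j y)).
Proof. by move=> cv; apply: gcontinuousM => //; exact: gcontinuous_expR. Qed.

Lemma kw_mass_unif (U : set_system nat) {FU : Filter U} p q :
  (forall k, gcontinuous (p k)) -> gcontinuous q -> gunif U p q ->
  forall e, 0 < e -> \forall k \near U, `|kw_mass (p k) - kw_mass q| <= e.
Proof.
move=> cp cq pq e e0.
have [M M0 hM] := gcontinuous_bounded hc.
have [B B0 qB] := gcontinuous_bounded cq.
pose W := M * expR (B + 1) * L.
have W0 : 0 < W by rewrite !mulr_gt0// expR_gt0.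
pose d := Num.min 1 (e / W).
have d0 : 0 < d by rewrite lt_min ltr01 divr_gt0.
have d1 : d <= 1 by rewrite ge_min lexx.
have de : d * W <= e by rewrite -ler_pdivlMr// ge_min lexx orbT.
near=> k.
have H : forall j y, y \in `[0, len j] -> `|p k j y - q j y| <= d.
  by near: k; exact: pq.
rewrite (le_trans _ de)//.
have -> : d * W = M * expR (B + 1) * d * L by rewrite /W; ring.
apply: ler_norm_gint_sub; [exact: gcontinuous_mass..|].
move=> j y yl; rewrite -mulrBr normrM -mulrA.
apply: ler_pM => //; first exact: hM.
move: (H j y yl) (qB j y yl) => H1 H2.
move: (H1) (H2); rewrite 2!ler_norml => /andP[? ?] /andP[? ?].
rewrite (@le_trans _ _ (expR (B + 1) * `|p k j y - q j y|))//.
  by apply: expR_lipschitz; lra.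
by rewrite ler_wpM2l ?expR_ge0.
Unshelve. all: by end_near. Qed.

(** On the constraint set the energy is bounded below, and it bounds both the
    Dirichlet energy and the function: the oscillation of [v] is controlled by
    the Poincare inequality, the constraint prevents [v] from being very
    negative, and the linear term of the energy from being very positive. *)
Lemma kw_coercive : exists K0 : R, forall J1 : R, exists B : R,
  forall v dv a, gC1 v dv a -> tau <= kw_mass v ->
    - K0 <= kw_energy v dv /\
    (kw_energy v dv <= J1 -> dirichlet dv <= B /\
      forall j y, y \in `[0, len j] -> `|v j y| <= B).
Proof.
have [M M0 hM] := gcontinuous_bounded hc.
have [C C0 HC] := poincare base.
(* the constraint forces [sup v >= ln (c / M)], and [ln (c / M) >= - M / c] *)
pose ka := M / c; have ka0 : 0 < ka by rewrite divr_gt0.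
pose K0 := tau * ka + 4 * tau ^+ 2 * C.
exists K0 => J1.
pose D1 := 4 * (`|J1| + K0); pose m1 := D1 / (8 * tau) + 2 * tau * C.
pose B := `|D1| + (`|J1| / tau + ka + 2 * m1).
exists B => v dv a Cv mv.
have cv := gC1_continuous Cv.
have D0 : 0 <= dirichlet dv by apply: dirichlet_ge0; case: Cv => _ cdv _.
set D := dirichlet dv in D0 *.
pose m := D / (8 * tau) + 2 * tau * C.
have m0 : 0 <= m.
  rewrite addr_ge0//; first by rewrite divr_ge0// mulr_ge0// ltW.
  by rewrite -mulrA !mulr_ge0 ?(ltW c0) ?(ltW L0) ?(ltW C0).
have vm j y : y \in `[0, len j] -> `|v j y - a base| <= m.
  move=> yl; apply: ler_norm_sqr => //.
  rewrite (le_trans (HC _ _ _ Cv j y yl))// -/(dirichlet dv) -/D.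
  (* arithmetic-geometric mean inequality for the two summands of m *)
  have amgm (p q : R) : 4 * (p * q) <= (p + q) ^+ 2.
    by have := sqr_ge0 (p - q); lra.
  rewrite (le_trans _ (amgm _ _))// le_eqVlt; apply/orP; left; apply/eqP.
  by field; rewrite !gt_eqF.
have ha : - ka <= a base + m.
  rewrite leNgt; apply/negP => lt.
  have : kw_mass v <= M * expR (a base + m) * L.
    rewrite -gint_cst; apply: le_gint.
    - exact: gcontinuous_mass.
    - exact: gcontinuous_cst.
    move=> j y yl; rewrite (le_trans (ler_norm _))// normrM.
    apply: ler_pM => //; first exact: hM.
    rewrite ger0_norm ?expR_ge0// ler_expR.
    by have := vm j y yl; rewrite ler_norml => /andP[]; lra.
  move=> /(le_trans mv); rewrite ler_pM2r// => H.
  have : c < c; last by rewrite ltxx.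
  rewrite (le_lt_trans H)// mulrC -ltr_pdivlMr//.
  rewrite (@lt_le_trans _ _ (expR (- ka)))// ?ltr_expR//.
  rewrite expRN invf_ple ?posrE ?expR_gt0// ?divr_gt0// invf_div -/ka.
  by have := expR_ge1Dx ka; lra.
have Jlow : tau * (a base - m) <= c * gint v.
  rewrite -mulrA ler_pM2l// mulrC -gint_cst; apply: le_gint => //.
    exact: gcontinuous_cst.
  by move=> j y /vm; rewrite ler_norml => /andP[]; lra.
have tm : tau * m = D / 8 + 2 * tau ^+ 2 * C.
  by rewrite /m; field; rewrite !gt_eqF.
have low : D / 4 - K0 <= kw_energy v dv.
  have : tau * - ka <= tau * (a base + m) by rewrite ler_pM2l.
  rewrite /kw_energy -/D /K0; lra.
split; first by lra.
move=> JJ1; have J1n := ler_norm J1.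
have DD1 : D <= D1 by rewrite /D1; lra.
have mm1 : m <= m1.
  by rewrite lerD2r// ler_pM2r// invr_gt0 mulr_gt0.
have aup : a base <= `|J1| / tau + m.
  rewrite -lerBlDr ler_pdivlMr// mulrC; move: JJ1 Jlow; rewrite /kw_energy -/D; lra.
have j1t : 0 <= `|J1| / tau by rewrite divr_ge0// ltW.
split.
  rewrite (le_trans DD1)// (le_trans (ler_norm _))// lerDl.
  by lra.
move=> j y /vm; rewrite !ler_norml => /andP[? ?].
have := normr_ge0 D1.
by move=> ?; apply/andP; split; rewrite /B; lra.
Qed.

(** Large multiples of a bump located where [h] is positive satisfy the
    constraint. *)
Lemma kw_feasible : (exists j y, (y \in `]0, len j[) /\ 0 < h j y) ->
  exists v dv a, gC1 v dv a /\ tau <= kw_mass v.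
Proof.
move=> [j [y [yl hy]]].
have [r r0 hr] : exists2 r : R, 0 < r & forall x, `|x - y| < r ->
    (x \in `]0, len j[) /\ 0 < h j x.
  have : \forall x \near y, (x \in `]0, len j[) /\ 0 < h j x.
    have hn : \forall x \near y, 0 < h j x.
      exact: (cvgr_gt (h j y) (@hc j y) 0 hy).
    near=> x; split; first by near: x; exact: near_in_itvoo.
    by near: x.
  move=> /nbhs_ballP[r /= r0 hr]; exists r => // x xr; apply: hr.
  by rewrite /ball/= distrC.
have [b [db [dbE cdb b0 by0 bout]]] := bump y r0.
have cb : continuous b by exact: continuous_of_is_derive dbE.
pose B k x := if k == j then b x else 0.
have cB : gcontinuous B.
  by move=> k; rewrite /B; case: eqP => // _ x; exact: cvg_cst.
have chB : gcontinuous (fun k x => h k x * B k x) by exact: gcontinuousM.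
have hB k x : 0 <= h k x * B k x.
  rewrite /B; case: eqP => [->|_]; last by rewrite mulr0.
  have [/bout->|xr] := leP r `|x - y|; first by rewrite mulr0.
  by rewrite mulr_ge0// ltW// (hr _ xr).2.
have I0 : 0 < gint (fun k x => h k x * B k x).
  rewrite /gint (bigD1 j)//= ltr_pwDl//.
    apply: (prim_gt0 (chB j) (fun x _ => hB j x) yl).
    by rewrite /B eqxx mulr_gt0.
  by apply: sumr_ge0 => k _; rewrite -(prim0 (chB k)) le_prim_sub ?glen_ge0.
set I := gint _ in I0.
pose K := `|tau - gint h| / I.
have K0 : 0 <= K by rewrite divr_ge0// ltW.
exists (fun k x => K * B k x), (fun k x => K * (if k == j then db x else 0)),
  (fun=> 0); split.
  split.
  - move=> k x; apply: is_derive_scalef; rewrite /B; case: eqP => // _.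
    exact: is_derive_cst.
  - move=> k; apply: continuousZf; case: eqP => // _ x; exact: cvg_cst.
  - move=> k; rewrite /B; case: eqP => [->|_]; last by rewrite mulr0.
    have far x : ~ (x \in `]0, len j[) -> b x = 0.
      by move=> xl; apply: bout; rewrite leNgt; apply/negP => /hr[].
    by split; rewrite far ?mulr0// in_itv/= ltxx ?andbF.
have -> : tau = gint h + (tau - gint h) by rewrite addrC subrK.
have KI : tau - gint h <= K * I by rewrite /K divfK ?gt_eqF// ler_norm.
rewrite (@le_trans _ _ (gint h + K * I))// ?lerD2l//.
rewrite /I -gintZ// -gintD//; last exact: gcontinuousZ.
apply: le_gint.
- by apply: gcontinuousD => //; exact: gcontinuousZ.
- by apply: gcontinuous_mass; exact: gcontinuousZ.
move=> k x _; rewrite /B; case: eqP => [->|_]; last by rewrite !mulr0 expR0 mulr1 addr0.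
have [/bout->|xr] := leP r `|x - y|; first by rewrite !mulr0 expR0 mulr1 addr0.
have := expR_ge1Dx (K * b x) => H.
have : h j x * (1 + K * b x) <= h j x * expR (K * b x).
  by rewrite ler_wpM2l// ltW// (hr _ xr).2.
lra.
Unshelve. all: by end_near. Qed.

End KazdanWarner.

Section Minimizer.
Context {R : realType} (G : metric_graph R).
Local Notation E := (gedge G).
Local Notation len := (@glen R G).
Local Notation L := (glength G).
Context (h : E -> R -> R) (c : R) (hc : gcontinuous h) (c0 : 0 < c) (j0 : E).
Implicit Types (v dv w dw u f : E -> R -> R) (a b : gvert G -> R).
Local Notation tau := (c * L).
Local Notation base := (gsrc j0).
Local Notation J := (kw_energy c).
Local Notation A := (kw_mass h).

Let L0 : 0 < L. Proof. exact: glength_gt0 j0. Qed.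
Let tau0 : 0 < tau. Proof. exact: mulr_gt0. Qed.
Let in0 j : 0 \in `[0, len j].
Proof. by rewrite in_itv/= lexx glen_ge0. Qed.

(** The function that the minimizing sequence is compared with. *)
Definition competitor (t s : R) v w : E -> R -> R :=
  fun j y => v j y + t * (w j y - v j y) + s.

Lemma gC1_competitor t s v dv a w dw b : gC1 v dv a -> gC1 w dw b ->
  gC1 (competitor t s v w) (fun j y => dv j y + t * (dw j y - dv j y))
    (fun i => a i + t * (b i - a i) + s).
Proof.
move=> [vd cdv va] [wd cdw wb]; split.
- move=> j y.
  have := is_derive_addf (is_derive_addf (vd j y) (is_derive_scalef t
    (is_derive_subf (wd j y) (vd j y)))) (is_derive_cst s y 1).
  by rewrite addr0.
- by apply: gcontinuousD => //; apply: gcontinuousZ; exact: gcontinuousB.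
- by move=> j; rewrite /competitor !(va j).1 !(va j).2 !(wb j).1 !(wb j).2.
Qed.

Lemma gcontinuous_competitor t s v w : gcontinuous v -> gcontinuous w ->
  gcontinuous (competitor t s v w).
Proof.
move=> cv cw; apply: gcontinuousD; last exact: gcontinuous_cst.
by apply: gcontinuousD => //; apply: gcontinuousZ; exact: gcontinuousB.
Qed.

Lemma kw_mass_shift t s v w : gcontinuous v -> gcontinuous w ->
  A (competitor t s v w) = expR s * A (competitor t 0 v w).
Proof.
move=> cv cw; rewrite /kw_mass -gintZ; last first.
  by apply: gcontinuous_mass => //; exact: gcontinuous_competitor.
congr gint; apply/funext => j; apply/funext => y.
by rewrite /competitor addr0 expRD; ring.
Qed.

(** The cross term is written with [dw] in place of [dv], so that Green's formula
    can be applied to it when [w] solves a Poisson problem. *)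
Lemma kw_energy_competitor t s v dv a w dw b : gC1 v dv a -> gC1 w dw b ->
  J (competitor t s v w) (fun j y => dv j y + t * (dw j y - dv j y)) =
  J v dv + t * gint (fun j y => dw j y * (dw j y - dv j y))
  - (t - t ^+ 2 / 2) * dirichlet (fun j y => dw j y - dv j y)
  + c * t * gint (fun j y => w j y - v j y) + tau * s.
Proof.
move=> Cv Cw; have cv := gC1_continuous Cv; have cw := gC1_continuous Cw.
case: Cv Cw => [_ cdv _] [_ cdw _].
have cd := gcontinuousB cdw cdv; have cp := gcontinuousB cw cv.
have cd2 := gcontinuousX2 cd; have cwd := gcontinuousM cdw cd.
rewrite /kw_energy.
have -> : gint (competitor t s v w) =
    gint v + t * gint (fun j y => w j y - v j y) + s * L.
  rewrite -gint_cst -gintZ// -gintD//; last exact: gcontinuousZ.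
  rewrite -gintD//; last exact: gcontinuous_cst.
  by apply: gcontinuousD => //; exact: gcontinuousZ.
have -> : dirichlet (fun j y => dv j y + t * (dw j y - dv j y)) =
    dirichlet dv + 2 * t * gint (fun j y => dw j y * (dw j y - dv j y))
    + (t ^+ 2 - 2 * t) * dirichlet (fun j y => dw j y - dv j y).
  rewrite /dirichlet -!gintZ// -!gintD//.
  - congr gint; apply/funext => j; apply/funext => y; ring.
  - by apply: gcontinuousD; [exact: gcontinuousX2|exact: gcontinuousZ].
  - exact: gcontinuousZ.
  - exact: gcontinuousX2.
  - exact: gcontinuousZ.
by field.
Qed.

Lemma gunif_gint (U : set_system nat) {FU : Filter U} p q (r : E -> R -> R) :
  (forall k, gcontinuous (p k)) -> gcontinuous q -> gcontinuous r ->
  gunif U p q -> forall e, 0 < e -> \forall k \near U,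
    `|gint (fun j y => r j y * p k j y) - gint (fun j y => r j y * q j y)| <= e.
Proof.
move=> cp cq cr pq e e0.
have [M M0 rM] := gcontinuous_bounded cr.
have d0 : 0 < e / (M * L) by rewrite divr_gt0// mulr_gt0.
apply: filterS (pq _ d0) => k H.
rewrite (_ : e = (M * (e / (M * L))) * L); last by field; rewrite !gt_eqF.
apply: ler_norm_gint_sub; [exact: gcontinuousM..|].
move=> j y yl; rewrite -mulrBr normrM; apply: ler_pM => //; first exact: rM.
exact: H.
Qed.

(** The sequence [v] minimizes the energy under the constraint, [m] is the
    infimum, and [v] converges uniformly to [u] along the filter [U]. *)
Record kw_minimizing (U : set_system nat) (m : R) (v dv : nat -> E -> R -> R)
    (a : nat -> gvert G -> R) (u : E -> R -> R) : Prop := KwMinimizing {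
  kwm_C1 : forall k, gC1 (v k) (dv k) (a k);
  kwm_mass : forall k, tau <= A (v k);
  kwm_lower : forall v dv a, gC1 v dv a -> tau <= A v -> m <= J v dv;
  kwm_min : forall e, 0 < e -> \forall k \near U, J (v k) (dv k) <= m + e;
  kwm_continuous : gcontinuous u;
  kwm_unif : gunif U v u
}.

Lemma kw_minimizing_exists : (exists v dv a, gC1 v dv a /\ tau <= A v) ->
  exists (U : set_system nat) (m : R) (v dv : nat -> E -> R -> R)
    (a : nat -> gvert G -> R) (u : E -> R -> R),
    UltraFilter U /\ kw_minimizing U m v dv a u.
Proof.
move=> [v1 [dv1 [a1 [Cv1 mv1]]]].
pose S := [set x : R | exists v dv a,
  [/\ gC1 v dv a, tau <= A v & x = J v dv]].
have [K0 HK] := kw_coercive hc c0 j0.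
have infS : has_inf S.
  split; first by exists (J v1 dv1), v1, dv1, a1.
  exists (- K0) => x [v [dv [a [Cv mv ->]]]].
  by have [B HB] := HK 0; have [] := HB v dv a Cv mv.
have /choice[x xP] (k : nat) :
    exists x : (E -> R -> R) * (E -> R -> R) * (gvert G -> R),
    [/\ gC1 x.1.1 x.1.2 x.2, tau <= A x.1.1 &
      J x.1.1 x.1.2 < inf S + k.+1%:R^-1].
  have k0 : 0 < (k.+1%:R^-1 : R) by rewrite invr_gt0.
  have [_ [v [dv [a [Cv mv ->]]]] lt] := inf_adherent k0 infS.
  by exists (v, dv, a).
pose v k := (x k).1.1; pose dv k := (x k).1.2; pose a k := (x k).2.
have Cv k : gC1 (v k) (dv k) (a k) by have [] := xP k.
have mv k : tau <= A (v k) by have [] := xP k.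
have Jv k : J (v k) (dv k) < inf S + k.+1%:R^-1 by have [] := xP k.
have [U [UU infU]] := ultraFilterLemma (@eventually_filter).
have [B HB] := HK (inf S + 1).
have bnd k : dirichlet (dv k) <= B /\
    forall j y, y \in `[0, len j] -> `|v k j y| <= B.
  have [_] := HB _ _ _ (Cv k) (mv k); apply.
  by rewrite (le_trans (ltW (Jv k)))// lerD2l invf_le1// ler1n.
have B0 : 0 <= B.
  rewrite (le_trans _ (bnd 0%N).1)//; apply: dirichlet_ge0.
  by case: (Cv 0%N) => _ cdv _.
have /choice[u uP] j : exists u : R -> R, continuous u /\ forall e, 0 < e ->
    \forall k \near U, forall y, y \in `[0, len j] -> `|v k j y - u y| <= e.
  have hol k (y z : R) : y \in `[0, len j] -> z \in `[0, len j] ->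
      (v k j z - v k j y) ^+ 2 <= B * `|z - y|.
    move=> yl zl; rewrite (le_trans (gC1_hoelder (Cv k) yl zl))// mulrC.
    by rewrite ler_wpM2r// (bnd k).1.
  have [u cu uP] :=
    ultra_arzela_ascoli (glen_ge0 j) B0 (fun k => (bnd k).2 j) hol.
  by exists u.
exists U, (inf S), v, dv, a, u; split=> //; split=> //.
- by move=> v' dv' a' Cv' mv'; apply: (ge_inf infS.2); exists v', dv', a'.
- move=> e e0; apply: infU.
  near=> k; rewrite (le_trans (ltW (Jv k)))// lerD2l.
  by apply: ltW; near: k; exact: (near_infty_natSinv_lt (PosNum e0)).
- by move=> j; case: (uP j).
- by move=> e e0; apply: filter_forall => j; exact: (uP j).2.
Unshelve. all: by end_near. Qed.


Section Limit.
Context (U : set_system nat) {UU : UltraFilter U} (m : R)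
  (v dv : nat -> E -> R -> R) (a : nat -> gvert G -> R) (u : E -> R -> R)
  (M : kw_minimizing U m v dv a u).

Let FU : Filter U. Proof. exact: filter_filter. Qed.

(** A strict inequality in the constraint passes from the limit [u] to the
    sequence, so the competitors built on [v k] are eventually admissible. *)
Lemma kw_competitor_lower t s w dw b : gC1 w dw b -> 0 <= t <= 1 ->
  tau < A (competitor t s u w) -> \forall k \near U,
    m <= J (competitor t s (v k) w)
           (fun j y => dv k j y + t * (dw j y - dv k j y)).
Proof.
move=> Cw /andP[t0 t1] Au.
have cw := gC1_continuous Cw; have cv k := gC1_continuous (kwm_C1 M k).
have cu := kwm_continuous M.
have un : gunif U (fun k => competitor t s (v k) w) (competitor t s u w).
  move=> e e0; apply: filterS (kwm_unif M e0) => k H j y yl.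
  rewrite /competitor (_ : _ - _ = (1 - t) * (v k j y - u j y)); last by ring.
  rewrite normrM ger0_norm ?subr_ge0//.
  rewrite -[e]mul1r; apply: ler_pM; rewrite ?subr_ge0 ?normr_ge0//; last exact: H.
  by rewrite gerBl.
have d0 : 0 < A (competitor t s u w) - tau by rewrite subr_gt0.
have N := kw_mass_unif (FU := FU) hc j0 (fun k => @gcontinuous_competitor t s _ _ (cv k) cw)
  (@gcontinuous_competitor t s _ _ cu cw) un d0.
apply: filterS N => k; rewrite ler_norml => /andP[H _].
apply: (kwm_lower M (gC1_competitor t s (kwm_C1 M k) Cw)); lra.
Qed.

(** The constraint is saturated by the limit of a minimizing sequence. *)
Lemma kw_limit_mass : A u = tau.
Proof.
have cv k := gC1_continuous (kwm_C1 M k).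
have cu := kwm_continuous M.
have Au : tau <= A u.
  apply/ler_addgt0Pr => e e0.
  have /filter_ex[k] := kw_mass_unif (FU := FU) hc j0 cv cu (kwm_unif M) e0.
  by rewrite ler_norml => /andP[_]; have := kwm_mass M k; lra.
apply/eqP; rewrite eq_le Au andbT leNgt; apply/negP => lt.
have A0 : 0 < A u by exact: lt_le_trans Au.
(* lowering [u] by this amount keeps the constraint, since [1 + s <= e^s] *)
pose s := - ((A u - tau) / (2 * A u)).
have s0 : s < 0 by rewrite oppr_lt0 divr_gt0 ?subr_gt0 ?mulr_gt0.
have us : competitor 0 0 u (v 0%N) = u.
  apply/funext => j; apply/funext => y.
  by rewrite /competitor mul0r !addr0.
have ms : tau < A (competitor 0 s u (v 0%N)).
  rewrite kw_mass_shift// us.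
  rewrite (@lt_le_trans _ _ ((1 + s) * A u))//; last first.
    by rewrite ler_pM2r// expR_ge1Dx.
  have -> : (1 + s) * A u = (A u + tau) / 2 by rewrite /s; field; rewrite gt_eqF.
  lra.
have t01 : 0 <= (0 : R) <= 1 by rewrite lexx ler01.
have H1 := kw_competitor_lower (kwm_C1 M 0%N) t01 ms.
have e0 : 0 < - (tau * s) / 2 by rewrite divr_gt0// -mulrN mulr_gt0// oppr_gt0.
have /filter_ex[k [/=]] := @filterI _ U FU _ _ H1 (kwm_min M e0).
rewrite (kw_energy_competitor _ _ (kwm_C1 M k) (kwm_C1 M 0%N)).
by rewrite !(expr0n, mul0r, mulr0, subr0, addr0)/=; lra.
Qed.

(** Comparison with the competitors [v k + t (w - v k) + s], in the limit. *)
Lemma kw_variation w dw b (C : R) : 0 < C ->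
  (forall v dv a, gC1 v dv a -> forall j y, y \in `[0, len j] ->
    (v j y - a base) ^+ 2 <= C * dirichlet dv) ->
  gC1 w dw b ->
  (forall j (y : R), is_derive y 1 (dw j) (c - h j y * expR (u j y))) ->
  kirchhoff dw -> b base = u j0 0 ->
  forall t s, 0 <= t <= 1 -> tau < A (competitor t s u w) ->
  forall j y, y \in `[0, len j] ->
    (t - t ^+ 2 / 2) * (w j y - u j y) ^+ 2 <=
      C * (t * gint (fun j y => h j y * expR (u j y) * (w j y - u j y)) + tau * s).
Proof.
move=> C0 HC Cw dwE kw bb t s t01 mts j y yl.
have cu := kwm_continuous M; have cw := gC1_continuous Cw.
have cv k := gC1_continuous (kwm_C1 M k).
have cm := gcontinuous_mass hc cu.
have [B B0 mB] := gcontinuous_bounded cm.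
set bb0 := gint _; pose phi := w j y - u j y.
have /andP[t0 t1] := t01.
have tq : 0 <= t - t ^+ 2 / 2 <= 1.
  have : 0 <= t * (2 - t) by rewrite mulr_ge0//; lra.
  by have := sqr_ge0 t => ? ?; apply/andP; split; lra.
have /andP[tq0 tq1] := tq.
apply/ler_addgt0Pr => e e0; rewrite -/phi.
pose W := 4 * `|phi| + C * 2.
have W0 : 0 < W by rewrite ltr_wpDl ?mulr_ge0// mulr_gt0.
pose d := e / W; have d0 : 0 < d by rewrite divr_gt0.
have cwv k : gcontinuous (fun j y => w j y - v k j y) by exact: gcontinuousB.
have cwu : gcontinuous (fun j y => w j y - u j y) by exact: gcontinuousB.
have un : gunif U (fun k j y => w j y - v k j y) (fun j y => w j y - u j y).
  move=> e' e'0; apply: filterS (kwm_unif M e'0) => k H j' y' yl'.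
  by rewrite (_ : _ - _ = - (v k j' y' - u j' y')) ?normrN ?H//; ring.
have N1 := kw_competitor_lower Cw t01 mts.
have N2 := kwm_min M d0.
have N3 := kwm_unif M d0.
have N4 := gunif_gint (FU := FU) cwv cwu cm un d0.
have /filter_ex[k [[/= n1 n2] [/= n3 n4]]] := @filterI _ U FU _ _
  (@filterI _ U FU _ _ N1 N2) (@filterI _ U FU _ _ N3 N4).
have [_ cdv vb] := kwm_C1 M k; have [_ cdw wb] := Cw.
have Cp : gC1 (fun j y => w j y - v k j y) (fun j y => dw j y - dv k j y)
    (fun i => b i - a k i).
  have [vd _ _] := kwm_C1 M k; have [wd _ _] := Cw; split.
  - by move=> j' y'; apply: is_derive_subf.
  - exact: gcontinuousB.
  - by move=> j'; rewrite (wb j').1 (wb j').2 (vb j').1 (vb j').2.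
set D := dirichlet (fun j y => dw j y - dv k j y).
have P := HC _ _ _ Cp j y yl; rewrite -/D in P.
(* the energy of the competitor, by Green's formula *)
have cf : gcontinuous (fun j y => c - h j y * expR (u j y)).
  by apply: gcontinuousB => //; exact: gcontinuous_cst.
have Gr := green Cp cf dwE kw.
move: n1; rewrite (kw_energy_competitor _ _ (kwm_C1 M k) Cw) Gr -/D.
have -> : gint (fun j y => (c - h j y * expR (u j y)) * (w j y - v k j y)) =
    c * gint (fun j y => w j y - v k j y)
    - gint (fun j y => h j y * expR (u j y) * (w j y - v k j y)).
  rewrite -gintZ// -gintB; first 1 last.
  - exact: gcontinuousZ.
  - exact: gcontinuousM.
  by congr gint; apply/funext => j'; apply/funext => y'; rewrite mulrBl.
move=> n1.
set I := gint (fun j y => h j y * expR (u j y) * (w j y - v k j y)) in n1 n4.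
set I1 := gint (fun j y => w j y - v k j y) in n1.
have {}n4 : I <= bb0 + d.
  by move: n4; rewrite ler_norml -/bb0 => /andP[_]; lra.
have key : (t - t ^+ 2 / 2) * D <= t * bb0 + tau * s + 2 * d.
  have : t * I <= t * (bb0 + d) by rewrite ler_wpM2l.
  have : t * d <= d by rewrite ger_pMl.
  lra.
have q : phi ^+ 2 - 4 * d * `|phi| <= (w j y - v k j y - (b base - a k base)) ^+ 2.
  set z := w j y - v k j y - (b base - a k base).
  have zphi : `|z - phi| <= 2 * d.
    have := n3 j0 0 (in0 j0); have := n3 j y yl.
    rewrite /z /phi bb (vb j0).1 !ler_norml => /andP[? ?] /andP[? ?].
    by apply/andP; split; lra.
  have : `|phi * (z - phi)| <= `|phi| * (2 * d) by rewrite normrM ler_wpM2l.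
  rewrite ler_norml => /andP[? _].
  by have := sqr_ge0 (z - phi); lra.
have S1 : (t - t ^+ 2 / 2) * (phi ^+ 2 - 4 * d * `|phi|) <=
    C * (t * bb0 + tau * s + 2 * d).
  rewrite (@le_trans _ _ ((t - t ^+ 2 / 2) * (C * D)))//.
    by rewrite ler_wpM2l// (le_trans q).
  by rewrite mulrCA ler_pM2l.
have dW : d * W = e by rewrite /d divfK// gt_eqF.
have : (t - t ^+ 2 / 2) * (4 * d * `|phi|) <= 4 * d * `|phi|.
  by rewrite ler_piMl// mulr_ge0// mulr_ge0// ltW.
rewrite -dW /W; lra.
Qed.

End Limit.

End Minimizer.

(** * The limit solves the equation *)

Section Solution.
Context {R : realType} (G : metric_graph R).
Local Notation E := (gedge G).
Local Notation len := (@glen R G).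
Local Notation L := (glength G).
Context (h : E -> R -> R) (c : R) (hc : gcontinuous h) (c0 : 0 < c) (j0 : E).
Local Notation tau := (c * L).
Local Notation base := (gsrc j0).
Local Notation A := (kw_mass h).

Let L0 : 0 < L. Proof. exact: glength_gt0 j0. Qed.
Let tau0 : 0 < tau. Proof. exact: mulr_gt0. Qed.

(** Lower bound of second order for the constraint along a line. *)
Lemma kw_mass_expansion u w : gcontinuous u -> gcontinuous w ->
  exists P K : R, [/\ 0 < P, 0 < K & forall t, 0 <= t -> t * P <= 2^-1 ->
    A u + t * gint (fun j y => h j y * expR (u j y) * (w j y - u j y))
      - K * t ^+ 2 <= A (competitor t 0 u w)].
Proof.
move=> cu cw.
have cm := gcontinuous_mass hc cu; have cp := gcontinuousB cw cu.
have [B B0 mB] := gcontinuous_bounded cm.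
have [P P0 pP] := gcontinuous_bounded cp.
exists P, (2 * B * P ^+ 2 * L); split=> //.
  by rewrite !mulr_gt0// exprn_gt0.
move=> t t0 tP.
have -> : 2 * B * P ^+ 2 * L * t ^+ 2 = (2 * B * P ^+ 2 * t ^+ 2) * L by ring.
have cmp := gcontinuousM cm cp.
rewrite -gint_cst -gintZ// -gintD//; last exact: gcontinuousZ.
rewrite -gintB//; last 2 first.
- by apply: gcontinuousD => //; exact: gcontinuousZ.
- exact: gcontinuous_cst.
apply: le_gint.
- apply: gcontinuousB; last exact: gcontinuous_cst.
  by apply: gcontinuousD => //; exact: gcontinuousZ.
- by apply: gcontinuous_mass => //; exact: gcontinuous_competitor.
move=> j y yl; rewrite /competitor addr0 expRD.
have := pP j y yl; have := mB j y yl.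
set H := h j y * expR (u j y); set x := w j y - u j y => HB xP.
have tx : `|t * x| <= 2^-1.
  by rewrite normrM ger0_norm// (le_trans _ tP)// ler_wpM2l.
have := expR_quadratic tx; set q := expR (t * x) - 1 - t * x => qb.
have -> : h j y * (expR (u j y) * expR (t * x)) = H * (1 + t * x + q).
  by rewrite /H /q; ring.
have : `|H * q| <= B * (2 * (t ^+ 2 * P ^+ 2)).
  rewrite normrM; apply: ler_pM => //; rewrite (le_trans qb)//.
  rewrite exprMn ler_pM2l// ler_wpM2l ?sqr_ge0//.
  rewrite -[x ^+ 2]real_normK ?num_real//.
  by rewrite lerXn2r// ?nnegrE// ltW.
rewrite ler_norml => /andP[? _]; lra.
Qed.

(** The limit [u] coincides with the solution [w] of [w'' = c - h e^u]. *)
Lemma kw_limit_solution (U : set_system nat) {UU : UltraFilter U} m v dv a u :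
  kw_minimizing h c U m v dv a u -> exists w dw b, [/\ gC1 (G := G) w dw b,
    forall j (y : R), y \in `[0, len j] ->
      is_derive y 1 (dw j) (c - h j y * expR (w j y)) & kirchhoff dw].
Proof.
move=> M; have cu := kwm_continuous M.
have cm := gcontinuous_mass hc cu.
have Au : A u = tau by exact: (kw_limit_mass hc c0 j0 M).
pose f j y := c - h j y * expR (u j y).
have cf : gcontinuous f by apply: gcontinuousB => //; exact: gcontinuous_cst.
have f0 : gint f = 0.
  rewrite gintB//; last exact: gcontinuous_cst.
  by rewrite gint_cst -/(kw_mass h u) Au subrr.
have [w [dw [b [Cw dwE kw bb]]]] := poisson base (u j0 0) cf f0.
have cw := gC1_continuous Cw.
exists w, dw, b; split=> // j y yl.
suff -> : w j y = u j y by exact: dwE.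
apply/eqP; rewrite -subr_eq0 -sqrf_eq0 eq_le sqr_ge0 andbT.
have [C C0 HC] := poincare base.
have var := kw_variation (UU := UU) hc M C0 HC Cw dwE kw bb.
have [P [K [P0 K0 exp]]] := kw_mass_expansion cu cw.
move: exp var; rewrite Au.
set B := gint _ => exp var.
(* the shift s = - t B / tau + K1 t^2 restores the constraint *)
pose be := `|B| / tau + 1; have be0 : 0 < be by rewrite ltr_wpDl ?divr_ge0// ltW.
pose K1 := (K + 2 * tau * be ^+ 2) / tau + 1.
have K1tau : tau * K1 = K + 2 * tau * be ^+ 2 + tau.
  by rewrite /K1; field; rewrite gt_eqF//= gt_eqF.
have K10 : 0 < K1.
  rewrite -(pmulr_rgt0 _ tau0) K1tau !addr_gt0// mulr_gt0 ?exprn_gt0//.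
  exact: mulr_gt0.
have small (t : R) : 0 < t -> t <= 1 -> t * P <= 2^-1 -> t * K1 <= 1 ->
    t * be <= 2^-1 -> (w j y - u j y) ^+ 2 <= 2 * C * (tau * K1) * t.
  move=> t0 t1 tP tK tb.
  pose s := - (t * (B / tau)) + K1 * t ^+ 2.
  have sb : `|s| <= t * be.
    rewrite (le_trans (ler_normD _ _))// normrN 3!normrM (gtr0_norm t0).
    rewrite normfV (gtr0_norm tau0) (gtr0_norm K10).
    rewrite (ger0_norm (sqr_ge0 t)) /be mulrDr mulr1 lerD2l.
    by rewrite expr2 mulrA mulrC ger_pMr// mulrC.
  have s2 : s ^+ 2 <= t ^+ 2 * be ^+ 2.
    rewrite -exprMn -[s ^+ 2]real_normK ?num_real//.
    by rewrite lerXn2r// ?nnegrE// mulr_ge0// ltW.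
  have ns : `|- s| <= 2^-1 by rewrite normrN (le_trans sb).
  have es := expR_quadratic_le ns.
  have ts : tau * s = - (t * B) + tau * K1 * t ^+ 2.
    by rewrite /s; field; rewrite gt_eqF//= gt_eqF.
  have t2 : 0 < tau * t ^+ 2 by rewrite mulr_gt0// exprn_gt0.
  have : tau < A (competitor t s u w).
    rewrite (kw_mass_shift hc)// -ltr_pdivrMl ?expR_gt0// -expRN mulrC.
    rewrite (lt_le_trans _ (exp t (ltW t0) tP))//.
    rewrite (@le_lt_trans _ _ (tau * (1 - s + 2 * s ^+ 2)))//.
      by rewrite ler_pM2l// -[s ^+ 2]sqrrN.
    have : tau * s ^+ 2 <= tau * (t ^+ 2 * be ^+ 2) by rewrite ler_pM2l.
    rewrite !mulrDr mulrN ts K1tau; lra.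
  have t01 : 0 <= t <= 1 by rewrite (ltW t0).
  move=> /(var t s t01)/(_ j y yl); rewrite ts.
  set X := (w j y - u j y) ^+ 2 => le1.
  have X0 : 0 <= X by exact: sqr_ge0.
  have le2 : t * (X / 2) <= t * (C * (tau * K1) * t).
    have : t ^+ 2 * X <= t * X by rewrite ler_wpM2r// expr2 ger_pMr.
    move: le1; lra.
  by move: le2; rewrite ler_pM2l//; lra.
apply/ler_addgt0Pr => e e0; rewrite add0r.
pose T := 2 * C * (tau * K1).
have T0 : 0 < T by rewrite !mulr_gt0.
pose t := Num.min 1 (Num.min (2^-1 / P) (Num.min K1^-1 (Num.min (2^-1 / be) (e / T)))).
have t0 : 0 < t by rewrite !lt_min ltr01 !divr_gt0// invr_gt0 K10.
have [t1 t2 t3 t4 t5] : [/\ t <= 1, t <= 2^-1 / P, t <= K1^-1,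
    t <= 2^-1 / be & t <= e / T].
  by split; rewrite /t !ge_min lexx ?orbT.
rewrite (le_trans (small t t0 t1 _ _ _))//.
- by rewrite -ler_pdivlMr.
- by rewrite -ler_pdivlMr// mul1r.
- by rewrite -ler_pdivlMr.
- by rewrite -/T mulrC -ler_pdivlMr.
Qed.

End Solution.

(** The Kazdan-Warner equation is solvable on a metric graph as soon as [h] is
    positive at an interior point of an edge. *)
Lemma kw_metric_graph {R : realType} (G : metric_graph R)
    (h : gedge G -> R -> R) (c : R) : gcontinuous h -> 0 < c ->
  (exists j y, (y \in `]0, glen j[) /\ 0 < h j y) ->
  exists w dw b, [/\ gC1 (G := G) w dw b,
    forall j (y : R), y \in `[0, glen j] ->
      is_derive y 1 (dw j) (c - h j y * expR (w j y)) & kirchhoff dw].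
Proof.
move=> hc c0 [j [y hy]].
have feas := kw_feasible c hc (ex_intro _ j (ex_intro _ y hy)).
have [U [m [v [dv [a [u [UU M]]]]]]] := kw_minimizing_exists hc c0 j feas.
exact: (kw_limit_solution hc c0 j M).
Qed.

(** * Topology of embedded networks *)

Section OneSided.
Context {R : realType}.

(** One-sided difference quotients of a function that is continuous on [[0, l]]
    and whose derivative extends to a continuous function [g] on [[0, l]]. *)
Lemma cvg_slope_right (f g : R -> R) (l : R) : 0 < l ->
  {within `[0, l], continuous f} -> {within `[0, l], continuous g} ->
  (forall y, y \in `]0, l[ -> is_derive y 1 f (g y)) ->
  (f y - f 0) / `|y - 0| @[y --> 0^'+] --> g 0.
Proof.
move=> l0 cf cg fg; have [_ g0 _] := (continuous_within_itvP g l0).1 cg.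
apply/cvgrPdist_le => e e0.
have /cvgrPdist_le/(_ e e0)[d /= d0 Hd] := g0.
near=> y.
have y0 : 0 < y by near: y; exact: nbhs_right_gt.
have yl : y < l by near: y; exact: nbhs_right_lt.
have yd : y < d by near: y; exact: nbhs_right_lt.
have sub : {within `[0, y], continuous f}.
  by apply: continuous_subspaceW cf; apply: subset_itvl; rewrite bnd_simp ltW.
have fgy z : z \in `]0, y[ -> is_derive z 1 f (g z).
  rewrite in_itv/= => /andP[z0 zy]; apply: fg; rewrite in_itv/= z0/=; lra.
have [z /[!in_itv]/= /andP[z0 zy] ->] := MVT y0 fgy sub.
rewrite subr0 (gtr0_norm y0) mulfK ?gt_eqF//; apply: Hd => //=.
by rewrite sub0r normrN gtr0_norm//; lra.
Unshelve. all: by end_near. Qed.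

Lemma cvg_slope_left (f g : R -> R) (l : R) : 0 < l ->
  {within `[0, l], continuous f} -> {within `[0, l], continuous g} ->
  (forall y, y \in `]0, l[ -> is_derive y 1 f (g y)) ->
  (f y - f l) / `|y - l| @[y --> l^'-] --> - g l.
Proof.
move=> l0 cf cg fg; have [_ _ gl] := (continuous_within_itvP g l0).1 cg.
apply/cvgrPdist_le => e e0.
have /cvgrPdist_le/(_ e e0)[d /= d0 Hd] := gl.
near=> y.
have y0 : 0 < y by near: y; exact: nbhs_left_gt.
have yl : y < l by near: y; exact: nbhs_left_lt.
have yd : l - d < y by near: y; apply: nbhs_left_gt; lra.
have sub : {within `[y, l], continuous f}.
  by apply: continuous_subspaceW cf; apply: subset_itvr; rewrite bnd_simp ltW.
have fgy z : z \in `]y, l[ -> is_derive z 1 f (g z).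
  rewrite in_itv/= => /andP[z0 zy]; apply: fg; rewrite in_itv/= zy andbT; lra.
have [z /[!in_itv]/= /andP[z0 zy] H] := MVT yl fgy sub.
have -> : f y - f l = - (g z * (l - y)) by rewrite -H opprB.
have ly : 0 < l - y by rewrite subr_gt0.
rewrite (distrC y) (gtr0_norm ly) mulNr mulfK ?gt_eqF//.
rewrite -opprD normrN; apply: Hd => //=.
by rewrite gtr0_norm ?subr_gt0//; lra.
Unshelve. all: by end_near. Qed.

(** Clamping to [[0, l]] extends a function continuous on [[0, l]] to the line. *)
Lemma continuous_clamp (f : R -> R) (l : R) : 0 <= l ->
  {within `[0, l], continuous f} ->
  continuous (fun y => f (Num.max 0 (Num.min y l))).
Proof.
move=> l0 /subspace_continuousP cf x.
pose cl (y : R) := Num.max 0 (Num.min y l).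
have clin y : `[0, l]%classic (cl y).
  by rewrite /= in_itv/= /cl le_max lexx ge_max l0 ge_min lexx orbT.
have ccl : continuous cl.
  move=> y; apply: (@continuous_max R R (fun=> 0) (fun y => Num.min y l)).
    exact: cvg_cst.
  by apply: (@continuous_min R R id (fun=> l)) => //; exact: cvg_cst.
apply: (@cvg_comp _ _ _ cl f _ _ _ _ (cf _ (clin x))) => W /ccl clW.
by apply: (@filterS _ (nbhs x) _ _ _ _ clW) => y; apply; exact: clin.
Qed.

End OneSided.

Section NetworkTopology.
Context {R : realType} {n : nat} (G : network R n).
Local Notation V := (vertex G).
Local Notation E := (edge G).
Local Notation len := (@elen R n G).
Local Notation pos := (@vpos R n G).
Local Notation par := (@epar R n G).
Context (s t : E -> V) (sE : forall j, pos (s j) = par j 0)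
  (tE : forall j, pos (t j) = par j (len j)).
Implicit Types (i : V) (j : E).

Lemma elen_ge0 j : 0 <= len j. Proof. exact/ltW/elen_gt0. Qed.

Lemma in_itv0 j : 0 \in `[0, len j].
Proof. by rewrite in_itv/= lexx elen_ge0. Qed.

Lemma in_itvl j : len j \in `[0, len j].
Proof. by rewrite in_itv/= lexx elen_ge0. Qed.

(** A closed edge meets the vertices only in its two ends. *)
Lemma vertex_on_edge i j (y : R) : y \in `[0, len j] -> par j y = pos i ->
  (y = 0 /\ i = s j) \/ (y = len j /\ i = t j).
Proof.
rewrite in_itv/= => /andP[y0 yl] yi.
have [y0'|y0'] := eqVneq y 0.
  by left; split=> //; apply: (@vpos_inj _ _ G); rewrite sE -yi y0'.
have [yl'|yl'] := eqVneq y (len j).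
  by right; split=> //; apply: (@vpos_inj _ _ G); rewrite tE -yi yl'.
have /seteqP[H _] := edge_no_vertex j.
have [] := H (pos i); split; last by exists i.
by exists y => //=; rewrite in_itv/= !lt_neqAle eq_sym y0' y0 yl' yl.
Qed.

Lemma src_neq_tgt j : s j != t j.
Proof.
apply/eqP => st; have /epar_inj := in_itvl j => /(_ 0 (in_itv0 j)).
rewrite -sE -tE st => /(_ erefl) l0.
by have := elen_gt0 j; rewrite l0 ltxx.
Qed.

(** The edge together with its two ends. *)
Definition closed_edge j : set 'rV[R]_n := par j @` `[0, len j].

Lemma closed_closed_edge j : closed (closed_edge j).
Proof.
apply: compact_closed; first exact: norm_hausdorff.
by apply: continuous_compact; [exact: epar_continuous|exact: segment_compact].
Qed.

(** Topological connectedness implies combinatorial connectedness. *)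
Lemma network_conn (P : V -> Prop) : (forall j, P (s j) <-> P (t j)) ->
  forall i0, P i0 -> forall i, P i.
Proof.
move=> Pe i0 P0 i; apply: contrapT => nPi.
(* two complementary closed pieces: the vertices with Q and the edges whose
   source has Q *)
pose C (Q : V -> Prop) := (pos @` [set i | Q i]) `|`
  \bigcup_(j in [set j | Q (s j)]) closed_edge j.
have closedC Q : closed (C Q).
  apply: closedU.
    apply: compact_closed; first exact: norm_hausdorff.
    by apply: finite_compact; apply: finite_image; exact: finite_finset.
  by apply: closed_bigcup => [|j _]; [exact: finite_finset|exact: closed_closed_edge].
have vC (Q : V -> Prop) k : (forall j, Q (s j) <-> Q (t j)) -> C Q (pos k) -> Q k.
  move=> Qe [[k' Qk' /vpos_inj <-//]|[j /= Qj [y yl yk]]].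
  by have [[_ ->]|[_ ->]] := vertex_on_edge yl yk; last apply/Qe.
have nPe j : ~ P (s j) <-> ~ P (t j).
  by split=> h /(Pe j).
have disj x : C P x -> C (fun k => ~ P k) x -> False.
  move=> CP CN; have [k xk] : range pos x.
    case: (CP) => [[k Pk <-]|[j Pj jx]]; first by exists k.
    case: CN => [[k Pk <-]|[j' Pj' jx']]; first by exists k.
    have jj' : j != j' by apply/eqP => jj; move: Pj'; rewrite -jj.
    exact: (edge_meet jj' (conj jx jx')).
  by move=> xE; move: CP CN; rewrite -xE => /(vC _ _ Pe) Pk /(vC _ _ nPe).
have cover x : net_points G x -> C P x \/ C (fun k => ~ P k) x.
  move=> [[k _ <-]|[j _ [y yl <-]]].
    have [Pk|nPk] := pselect (P k); first by left; left; exists k.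
    by right; left; exists k.
  have jy : closed_edge j (par j y).
    by exists y => //; move: yl; exact: subset_itv_oo_cc.
  have [Pj|nPj] := pselect (P (s j)); first by left; right; exists j.
  by right; right; exists j.
have NP : net_points G `&` C P = net_points G.
  have conn : connected (net_points G) := @network_connected _ _ G.
  apply: conn.
  - by exists (pos i0); split; [left; exists i0|left; exists i0].
  - exists (~` C (fun k => ~ P k)); first exact: closed_openC.
    apply/seteqP; split=> x [nx Cx]; split=> //.
      by move=> Nx; exact: disj Cx Nx.
    by have [] := cover x nx.
  - by exists (C P).
have Ni : net_points G (pos i) by left; exists i.
by move: Ni; rewrite -NP => -[_ /(vC _ _ Pe)].
Qed.

Lemma ecoordK j (y : R) : y \in `[0, len j] -> ecoord j (par j y) = y.
Proof.
move=> yl; apply: pinvKV; last by rewrite mem_setE.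
by move=> y1 y2; rewrite !mem_setE; exact: epar_inj.
Qed.

(** The inverse of an edge parametrization is continuous, because the image of
    the compact set of parameters at distance at least [e] of [y0] is closed. *)
Lemma cvg_ecoord j (y0 : R) : y0 \in `[0, len j] ->
  ecoord j x @[x --> within (edge_set j) (nbhs (par j y0))] --> y0.
Proof.
move=> y0l; apply/cvgrPdist_lt => e e0.
pose K := par j @` (`[0, len j] `&` ~` (ball y0 e)).
have cK : closed K.
  apply: compact_closed; first exact: norm_hausdorff.
  apply: continuous_compact.
    exact: (continuous_subspaceW (@subIsetl _ _ _) (@epar_continuous _ _ G j)).
  apply: compact_closedI; first exact: segment_compact.
  by apply: open_closedC; exact: ball_open.
have nK : (~` K) (par j y0).
  move=> [y [/= yl yb]] /(epar_inj yl y0l) yy; apply: yb; rewrite yy.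
  exact: ballxx.
have : nbhs (par j y0) (~` K) by apply: open_nbhs_nbhs; split=> //; exact: closed_openC.
apply: filterS => x nKx [y yl xE]; rewrite -xE in nKx *.
have yl' : y \in `[0, len j] by move: yl; exact: subset_itv_oo_cc.
rewrite ecoordK// ltNge; apply/negP => ye; apply: nKx.
by exists y => //; split=> //; rewrite /ball/= => /lt_geF; rewrite ye.
Qed.

End NetworkTopology.

(** * Oriented derivatives at the vertices *)

Section NetworkCalculus.
Context {R : realType} {n : nat} (G : network R n).
Local Notation V := (vertex G).
Local Notation E := (edge G).
Local Notation len := (@elen R n G).
Local Notation pos := (@vpos R n G).
Local Notation par := (@epar R n G).
Context (s t : E -> V) (sE : forall j, pos (s j) = par j 0)
  (tE : forall j, pos (t j) = par j (len j)).
Implicit Types (i : V) (j : E) (u h : 'rV[R]_n -> R).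

Lemma incidentE i j : incident i j = (s j == i) || (t j == i).
Proof.
rewrite /incident -sE -tE !(inj_eq (@vpos_inj _ _ G)).
by rewrite [i == _]eq_sym [i == t j]eq_sym.
Qed.

(** When a point converges to the vertex along the edge, its parameter converges
    to [y0] inside the edge; so the oriented derivative is the limit of
    difference quotients in the parameter. *)
Lemma oriented_derivative_eq u j i (y0 d : R) : y0 \in `[0, len j] ->
  ProperFilter (within `]0, len j[ (nbhs y0)) -> pos i = par j y0 ->
  (on_edge u j y - on_edge u j y0) / `|y - y0|
    @[y --> within `]0, len j[ (nbhs y0)] --> d ->
  oriented_derivative u j i = d.
Proof.
move=> y0l FF iE slope; set F := within `]0, len j[ (nbhs y0) in FF slope.
set W := within (edge_set j) (nbhs (pos i)).
have FW S : W S -> F (par j @^-1` S).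
  have /subspace_continuousP/(_ y0 y0l) cp := @epar_continuous _ _ G j.
  rewrite /W iE => /cp; apply: (@filterS _ (nbhs y0)) => y H yl; apply: H.
    by move: yl; exact: subset_itv_oo_cc.
  by exists y.
have PW : ProperFilter W.
  split; last exact: within_filter.
  by move=> /FW; rewrite preimage_set0; exact: filter_not_empty.
have eW : ecoord j x @[x --> W] --> F.
  move=> S FS; have H := cvg_ecoord y0l FS.
  rewrite -iE -/W in H.
  have HE : W (edge_set j) by exact: withinT.
  apply: (@filterS _ W _ _ _ _ (@filterI _ W _ _ _ H HE)) => x [/= Hx [y yl yx]].
  apply: Hx; rewrite -yx ecoordK//; exact: subset_itv_oo_cc.
rewrite /oriented_derivative; apply: cvg_lim => //.
rewrite /at_vertex iE ecoordK//.
rewrite -iE -/W.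
exact: (@cvg_comp _ _ _ (ecoord j)
  (fun y => (on_edge u j y - on_edge u j y0) / `|y - y0|) W F _ eW slope).
Qed.

Lemma right_filterE (l : R) : 0 < l -> within `]0, l[ (nbhs (0 : R)) = 0^'+.
Proof.
move=> l0; apply/seteqP; split=> S; rewrite /at_right/within/=; last first.
  by apply: filterS => y Sy /=; rewrite in_itv/= => /andP[? _]; exact: Sy.
move=> H; near=> y => y0; have Hy : y \in `]0, l[ -> S y by near: y.
apply: Hy; rewrite in_itv/= y0/=.
by near: y; exact: lt_nbhsl.
Unshelve. all: by end_near. Qed.

Lemma left_filterE (l : R) : 0 < l -> within `]0, l[ (nbhs l) = l^'-.
Proof.
move=> l0; apply/seteqP; split=> S; rewrite /at_left/within/=; last first.
  by apply: filterS => y Sy /=; rewrite in_itv/= => /andP[_ ?]; exact: Sy.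
move=> H; near=> y => y0; have Hy : y \in `]0, l[ -> S y by near: y.
apply: Hy; rewrite in_itv/= y0 andbT.
by near: y; exact: lt_nbhsr.
Unshelve. all: by end_near. Qed.

(** [u] is continuous along the edge [j], and its derivative there extends to
    [g], continuous up to the ends. *)
Definition edge_C1 u j (g : R -> R) := [/\
  {within `[0, len j], continuous (on_edge u j)},
  {within `[0, len j], continuous g} &
  forall y : R, y \in `]0, len j[ -> is_derive y 1 (on_edge u j) (g y)].

Lemma oriented_derivative_src u j g : edge_C1 u j g ->
  oriented_derivative u j (s j) = g 0.
Proof.
move=> [cf cg fg]; have l0 := elen_gt0 j.
apply: (oriented_derivative_eq (in_itv0 j) _ (sE j)).
  rewrite right_filterE//; exact: at_right_proper_filter.
by rewrite right_filterE//; exact: cvg_slope_right.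
Qed.

Lemma oriented_derivative_tgt u j g : edge_C1 u j g ->
  oriented_derivative u j (t j) = - g (len j).
Proof.
move=> [cf cg fg]; have l0 := elen_gt0 j.
apply: (oriented_derivative_eq (in_itvl j) _ (tE j)).
  rewrite left_filterE//; exact: at_left_proper_filter.
by rewrite left_filterE//; exact: cvg_slope_left.
Qed.

Lemma sum_oriented_derivative u (g : E -> R -> R) i :
  (forall j, edge_C1 u j (g j)) ->
  \sum_(j | incident i j) oriented_derivative u j i =
  \sum_(j | s j == i) g j 0 - \sum_(j | t j == i) g j (len j).
Proof.
move=> Cu; rewrite (bigID (fun j => s j == i))/= -sumrN; congr (_ + _).
  apply: eq_big => [j|j /andP[_ /eqP <-]].
    by rewrite incidentE; case: (s j == i); rewrite ?andbF.
  exact: oriented_derivative_src.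
apply: eq_big => [j|j /andP[+ sji]].
  rewrite incidentE; case: (eqVneq (s j) i) => [<-|_]/=; last by rewrite andbT.
  by rewrite eq_sym (negPf (src_neq_tgt sE tE j)).
rewrite incidentE (negPf sji)/= => /eqP <-.
exact: oriented_derivative_tgt.
Qed.

End NetworkCalculus.

(** * The Kazdan-Warner equation on a network *)

Section KazdanWarnerNetwork.
Context {R : realType} {n : nat} (G : network R n).
Local Notation V := (vertex G).
Local Notation E := (edge G).
Local Notation len := (@elen R n G).
Local Notation pos := (@vpos R n G).
Local Notation par := (@epar R n G).

Lemma network_ends : exists s t : E -> V,
  (forall j, pos (s j) = par j 0) /\ (forall j, pos (t j) = par j (len j)).
Proof.
have /choice[s sE] j : exists i, pos i = par j 0.
  by have [i _ iE] := epar_left j; exists i.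
have /choice[t tE] j : exists i, pos i = par j (len j).
  by have [i _ iE] := epar_right j; exists i.
by exists s, t.
Qed.

Lemma par_net_points j (y : R) : y \in `]0, len j[ -> net_points G (par j y).
Proof. by move=> yl; right; exists j => //; exists y. Qed.

(** If [h <= 0] everywhere, the derivative of a solution increases strictly
    along each edge, so the sum of all oriented derivatives is negative. *)
Lemma kw_necessary (h u : 'rV[R]_n -> R) (c : R) : 0 < c ->
  kazdan_warner_solution G c h u ->
  [set x | net_points G x /\ 0 < h x] !=set0.
Proof.
move=> c0 [[[cu vu] C2u] eqn _ kir].
have [s [t [sE tE]]] := network_ends.
apply: contrapT => /set0P/negP/negPn/eqP/seteqP[h0 _].
have hle x : net_points G x -> h x <= 0.
  by move=> nx; rewrite leNgt; apply/negP => hx; exact: (h0 x (conj nx hx)).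
have /choice[g gP] j : exists g : R -> R, edge_C1 u j g /\ g 0 < g (len j).
  have [cf df d2f /(_ 1%N isT)[g cg fg]] := C2u j.
  have l0 := elen_gt0 j.
  exists g; split.
    split=> // y yl; rewrite -(fg y yl) /= derive1E.
    by apply: derivableP; exact: df.
  have gd (y : R) : y \in `]0, len j[ ->
      is_derive y 1 g (c - on_edge h j y * expR (on_edge u j y)).
    move=> yl; rewrite -eqn//=.
    apply: (@near_eq_is_derive _ _ _ (on_edge u j)^`()%classic).
      near=> z; rewrite -fg//.
      by near: z; exact: near_in_itvoo.
    by rewrite derive1E; apply: derivableP; exact: d2f.
  have [z zl e] := MVT l0 gd cg.
  rewrite -subr_gt0 e subr0 mulr_gt0// subr_gt0.
  rewrite (le_lt_trans _ c0)// mulr_le0_ge0 ?expR_ge0//.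
  by apply: hle; exact: par_net_points.
have tot : \sum_(i : V) \sum_(j | incident i j) oriented_derivative u j i =
    \sum_j (g j 0 - g j (len j)).
  have fub (w : E -> V) (H : E -> R) : \sum_i \sum_(j | w j == i) H j = \sum_j H j.
    by rewrite [RHS](partition_big w xpredT).
  rewrite sumrB -(fub s (fun j => g j 0)) -(fub t (fun j => g j (len j))).
  rewrite -sumrB; apply: eq_bigr => i _.
  exact: (sum_oriented_derivative sE tE _ (fun j => (gP j).1)).
move: tot; rewrite big1; last by move=> i _; exact: kir.
have /card_gt0P[j _] := edge_nonempty G.
suff lt : \sum_j (g j 0 - g j (len j)) < 0.
  by move=> e; move: lt; rewrite -e ltxx.
rewrite (bigD1 j)//= -[ltRHS]addr0; apply: ltr_leD.
  by rewrite subr_lt0 (gP j).2.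
by apply: sumr_le0 => k _; rewrite subr_le0 ltW// (gP k).2.
Unshelve. all: by end_near. Qed.

(** Positivity of [h] at a point of the network gives positivity at an interior
    point of an edge, since every vertex is incident to an edge. *)
Lemma interior_positive (h : 'rV[R]_n -> R) (x : 'rV[R]_n) :
  (forall j, {within `[0, len j], continuous (on_edge h j)}) ->
  net_points G x -> 0 < h x ->
  exists j (y : R), (y \in `]0, len j[) /\ 0 < on_edge h j y.
Proof.
move=> ch [[i _ <-]|[j _ [y yl <-]]] hx; last by exists j, y.
have [s [t [sE tE]]] := network_ends.
have [j inc] : exists j, s j = i \/ t j = i.
  apply: contrapT => noinc.
  have /card_gt0P[j1 _] := edge_nonempty G.
  apply: (noinc); exists j1; left; apply: (network_conn sE tE (P := fun k => k = i) _ erefl) => j.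
  by split=> ji; case: noinc; exists j; [left|right].
have [cj c0 cl] := (continuous_within_itvP _ (elen_gt0 j)).1 (ch j).
have l0 := elen_gt0 j.
exists j; case: inc => ji.
  have h0 : 0 < on_edge h j 0 by rewrite /on_edge/= -sE ji.
  near (0 : R)^'+ => y; exists y; split; last first.
    by near: y; exact: (cvgr_gt (on_edge h j 0) c0 0 h0).
  by rewrite in_itv/=; apply/andP; split; near: y;
    [exact: nbhs_right_gt|exact: nbhs_right_lt].
have h0 : 0 < on_edge h j (len j) by rewrite /on_edge/= -tE ji.
near (len j)^'- => y; exists y; split; last first.
  by near: y; exact: (cvgr_gt (on_edge h j (len j)) cl 0 h0).
by rewrite in_itv/=; apply/andP; split; near: y;
  [exact: nbhs_left_gt|exact: nbhs_left_lt].
Unshelve. all: by end_near. Qed.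

(** Functions on the edges that agree at the vertices glue together. *)
Lemma glue_edges (s t : E -> V) (w : E -> R -> R) (b : V -> R) :
  (forall j, pos (s j) = par j 0) -> (forall j, pos (t j) = par j (len j)) ->
  (forall j, w j 0 = b (s j) /\ w j (len j) = b (t j)) ->
  exists u : 'rV[R]_n -> R, forall j (y : R), y \in `[0, len j] ->
    on_edge u j y = w j y.
Proof.
move=> sE tE wb.
have vw i j y : y \in `[0, len j] -> par j y = pos i -> w j y = b i.
  move=> yl yi; have [[-> ->]|[-> ->]] := vertex_on_edge sE tE yl yi.
    by rewrite (wb j).1.
  by rewrite (wb j).2.
have /choice[u uP] x : exists r, forall j (y : R), y \in `[0, len j] ->
    par j y = x -> w j y = r.
  have [[j [y [yl yx]]]|nx] :=
      pselect (exists j (y : R), y \in `[0, len j] /\ par j y = x).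
    exists (w j y) => j' y' yl' yx'.
    have [jj|jj] := eqVneq j j'.
      rewrite -jj in yl' yx' *; congr (w j _).
      by apply: epar_inj yl' yl _; rewrite yx yx'.
    have [i _ iE] : range pos x.
      by apply: (edge_meet jj); split; [exists y|exists y'].
    by rewrite (vw i j) ?iE// (vw i j') ?iE.
  by exists 0 => j y yl yx; case: nx; exists j, y.
by exists u => j y yl; rewrite /on_edge/=; apply/esym; exact: uP yl _.
Qed.

Lemma kw_sufficient (h : 'rV[R]_n -> R) (c : R) : net_continuous G h -> 0 < c ->
  [set x | net_points G x /\ 0 < h x] !=set0 ->
  exists u : 'rV[R]_n -> R, kazdan_warner_solution G c h u.
Proof.
move=> [ch vh] c0 [x [nx hx]].
have [j1 [y1 [yl1 hy1]]] := interior_positive ch nx hx.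
have [s [t [sE tE]]] := network_ends.
(* [h] is clamped outside each parameter interval to be continuous on the line *)
pose MG := @MetricGraph R V E s t len (@elen_gt0 _ _ G) (network_conn sE tE).
pose hh (j : gedge MG) (y : R) := on_edge h j (Num.max 0 (Num.min y (len j))).
have hhE j (y : R) : y \in `[0, len j] -> hh j y = on_edge h j y.
  by rewrite in_itv/= /hh => /andP[? ?]; rewrite min_l// max_r.
have chh : gcontinuous hh.
  by move=> j; apply: continuous_clamp; [exact: elen_ge0|exact: ch].
have pos1 : exists j y, (y \in `]0, glen j[) /\ 0 < hh j y.
  exists j1, y1; split=> //.
  by rewrite hhE//; exact: subset_itv_oo_cc.
have [w [dw [b [[wd cdw wb] dwE kw]]]] := kw_metric_graph chh c0 pos1.
have cw j : continuous (w j) by exact: continuous_of_is_derive (wd j).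
have [u uE] := glue_edges sE tE wb.
exists u.
have oo_cc j (y : R) : y \in `]0, len j[ -> y \in `[0, len j].
  exact: subset_itv_oo_cc.
have cu j : {within `[0, len j], continuous (on_edge u j)}.
  apply: (@subspace_eq_continuous _ _ _ (w j)).
    by move=> y; rewrite mem_setE => yl; rewrite [LHS]/= -uE.
  exact: continuous_subspaceT.
have d1 j (y : R) : y \in `]0, len j[ -> is_derive y 1 (on_edge u j) (dw j y).
  move=> yl; apply: (@near_eq_is_derive _ _ _ (w j)) => //.
  near=> z; apply/esym/uE/oo_cc.
  by near: z; exact: near_in_itvoo.
have e1 j (y : R) : y \in `]0, len j[ -> (on_edge u j)^`()%classic y = dw j y.
  by move=> yl; rewrite derive1E; have [_ ->] := d1 j y yl.
have d2 j (y : R) : y \in `]0, len j[ ->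
    is_derive y 1 (on_edge u j)^`()%classic (c - hh j y * expR (w j y)).
  move=> yl; apply: (@near_eq_is_derive _ _ _ (dw j)).
    near=> z; apply/esym/e1.
    by near: z; exact: near_in_itvoo.
  by apply: dwE; exact: oo_cc.
have e2 j (y : R) : y \in `]0, len j[ ->
    (on_edge u j)^`(2)%classic y = c - hh j y * expR (w j y).
  by move=> yl; rewrite /= derive1E; have [_ ->] := d2 j y yl.
have vu : @vertex_compatible _ _ G u.
  have atE i j : incident i j -> at_vertex u j i = u (pos i).
    move=> inc; rewrite /at_vertex /on_edge/=; congr u.
    by case/orP: inc => /eqP ->; rewrite ecoordK//; [exact: in_itv0|exact: in_itvl].
  by move=> i j k ij ik; rewrite !atE.
split=> //.
- split; first by split.
  move=> j; split=> //.
  + by move=> y /d1[].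
  + by move=> y /d2[].
  + case=> [//|[|[|//]]] _.
      exists (dw j); last by move=> y /e1.
      exact: continuous_subspaceT.
    exists (fun y => c - hh j y * expR (w j y)); last by move=> y /e2.
    apply: continuous_subspaceT; apply: continuousBf.
      by move=> y; exact: cvg_cst.
    by apply: continuousMf; [exact: chh|exact: continuous_expRf].
- by move=> j y yl; rewrite e2// hhE ?uE//; exact: oo_cc.
- move=> i; rewrite (@sum_oriented_derivative _ _ _ s t sE tE u dw).
    by apply/eqP; rewrite subr_eq0; apply/eqP; exact: kw.
  by move=> j; split=> //; [exact: continuous_subspaceT|exact: d1].
Unshelve. all: by end_near. Qed.

End KazdanWarnerNetwork.

Theorem theorem4p1 (R : realType) (n : nat) (G : network R n)
    (h : 'rV[R]_n -> R) (c : R) :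
  net_continuous G h -> 0 < c ->
  (exists u : 'rV[R]_n -> R, kazdan_warner_solution G c h u) <->
  [set x | net_points G x /\ 0 < h x] !=set0.
Proof.
move=> ch c0; split=> [[u]|]; first exact: kw_necessary.
exact: kw_sufficient.
Qed.
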